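(* Let $d_0$ be the spherical metric on $\mathbb S^2$. Among all metrics $d$ on $\mathbb S^2$ that induce the standard topology of $\mathbb S^2$ and satisfy $d\ge d_0$ (that is, $d(x,y)\ge d_0(x,y)$ for all $x,y\in\mathbb S^2$), the map $d\mapsto \mathcal H^2_d(\mathbb S^2)$ has a unique minimum, attained by the spherical metric. That is, for every such $d$ one has $\mathcal H^2_d(\mathbb S^2)\ge \mathcal H^2_{d_0}(\mathbb S^2)$, with equality only if $d=d_0$.
   Context: The spherical metric $d_0$ is the Riemannian (geodesic) distance on the unit sphere $\mathbb S^2$. $\mathcal H^2_d$ denotes the Hausdorff $2$-measure with respect to the metric $d$, normalized so that it coincides with Lebesgue measure in $\mathbb R^2$; it may take the value $\infty$. *)

(* Defs.v *)
From mathcomp Require Import all_boot all_order all_algebra.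
From mathcomp Require Import all_classical all_reals all_analysis.
Import Order.TTheory GRing.Theory Num.Theory numFieldNormedType.Exports.

Set Implicit Arguments.
Unset Strict Implicit.
Unset Printing Implicit Defensive.

Local Open Scope classical_set_scope.
Local Open Scope ring_scope.

(* The library norm on 'rV[R]_3 is the sup norm; it induces the same topology
   and the same derivatives, but lengths need the Euclidean one. *)
Definition eucl_norm (R : realType) (v : 'rV[R]_3) : R :=
  Num.sqrt (\sum_(i < 3) v 0 i ^+ 2).

Definition unit_sphere (R : realType) : set 'rV[R]_3 :=
  [set v | eucl_norm v = 1].

(* As a [set_type], the sphere carries the topology induced by 'rV[R]_3. *)
Definition S2 (R : realType) := set_type (@unit_sphere R).

Definition C1_curve (R : realType) (g : R -> 'rV[R]_3) : Prop :=
  (forall t, derivable g t 1) /\ continuous (g^`())%classic.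

(* 0 < s_0 < ... < s_k = 1 is a subdivision of [0, 1] and, on each closed
   subinterval, c agrees with a curve that is C^1 on all of R (equivalently,
   c is C^1 there, one-sidedly at the endpoints). *)
Definition piecewise_C1 (R : realType) (c : R -> 'rV[R]_3) : Prop :=
  exists s : seq R, [/\ path <%R 0 s, last 0 s = 1 &
    forall i, (i < size s)%N -> exists g : R -> 'rV[R]_3,
      C1_curve g /\
      forall t, nth 0 (0 :: s) i <= t <= nth 0 s i -> c t = g t].

Definition sphere_curve (R : realType) (x y : S2 R) (c : R -> 'rV[R]_3) : Prop :=
  [/\ piecewise_C1 c, forall t, 0 <= t <= 1 -> unit_sphere (c t),
      c 0 = \val x & c 1 = \val y].

(* For a piecewise C^1 curve, [c^`()] is the actual velocity on [0, 1] except
   at finitely many points, which do not affect the integral. *)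
Definition curve_length (R : realType) (c : R -> 'rV[R]_3) : R :=
  \int[lebesgue_measure]_(t in `[0, 1]) eucl_norm ((c^`())%classic t).

Definition spherical_dist (R : realType) (x y : S2 R) : R :=
  inf [set curve_length c | c in sphere_curve x y].

Record is_metric (R : realType) (T : Type) (d : T -> T -> R) : Prop := {
  metric_ge0 : forall x y, 0 <= d x y;
  metric_eq0 : forall x y, d x y = 0 <-> x = y;
  metric_sym : forall x y, d x y = d y x;
  metric_triangle : forall x y z, d x z <= d x y + d y z }.

Definition induces_topology (R : realType) (T : topologicalType)
    (d : T -> T -> R) : Prop :=
  forall U : set T, open U <->
    forall x, U x -> exists2 e : R, 0 < e & [set y | d x y < e] `<=` U.

(* The element 0 is adjoined so that the empty set has diameter 0. *)
Definition diam (R : realType) (T : Type) (d : T -> T -> R) (A : set T) : \bar R :=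
  ereal_sup ([set 0%E] `|` [set (d x y)%:E | x in A & y in A]).

(* pi / 4 = omega_2 / 2 ^ 2, with omega_2 = pi the area of the unit disc, is
   the factor for which Hausdorff 2-measure on the Euclidean plane is Lebesgue
   measure. *)
Definition hausdorff2_pre (R : realType) (T : Type) (d : T -> T -> R)
    (delta : R) (A : set T) : \bar R :=
  ereal_inf [set (\sum_(i <oo) (pi / 4)%:E * diam d (C i) ^+ 2)%E |
    C in [set C : nat -> set T | A `<=` \bigcup_i C i /\
                                 forall i, (diam d (C i) <= delta%:E)%E]].

Definition hausdorff2 (R : realType) (T : Type) (d : T -> T -> R)
    (A : set T) : \bar R :=
  ereal_sup [set hausdorff2_pre d delta A | delta in [set e : R | 0 < e]].

Definition admissible (R : realType) (d : S2 R -> S2 R -> R) : Prop :=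
  [/\ is_metric d, induces_topology d &
      forall x y, spherical_dist x y <= d x y].

(* Main.v *)
Require Import Defs.
From mathcomp Require Import all_boot all_order all_algebra.
From mathcomp Require Import all_classical all_reals all_analysis.
From mathcomp Require Import measurable_realfun ring lra.
Import Order.TTheory GRing.Theory Num.Theory numFieldNormedType.Exports.

Set Implicit Arguments.
Unset Strict Implicit.
Unset Printing Implicit Defensive.

Local Open Scope classical_set_scope.
Local Open Scope ring_scope.

(**
Write [f] for [d x0], which is 1-Lipschitz for [d]. As [spherical_dist] is an
infimum of lengths of curves, it suffices to show that [f] is locally
[(1 + e)]-Lipschitz for the chordal distance, for every [e > 0].

Let [t >= 1] be the optimal local Lipschitz constant of [f], nearly attained
on a short arc from [y] to [z], and consider a thin rectangle (in the plane of
an orthogonal projection) around it, whose rows run parallel to the arc. If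
[C] has [d]-diameter [r], then the rows on which the oscillation of [f] on [C]
is at least [m] have points of [C] at distance [m / t], so they lie within a
band of height [sqrt (r ^ 2 - (m / t) ^ 2)]; moreover [m <= r]. Integrating
over [m] and then over the rows, a cover of the rectangle by sets of diameters
[r i] satisfies

  t * area <= (sum of the [r i ^ 2]) * (integral over m in [0, 1] of
                                        sqrt (1 - (m / t) ^ 2)).

On the other hand, filling squares with discs shows that the spherical
Hausdorff measure is at most [pi / 4 * area / (integral over m in [0, 1] of
sqrt (1 - m ^ 2))]. When the total measures agree, so do those of the
rectangle, whence [t * (integral of sqrt (1 - m ^ 2))] is at most [integral of
sqrt (1 - (m / t) ^ 2)], which forces [t = 1]. The two integrals enter only as
Riemann sums, and neither their value nor that of [pi] matters.
*)

(** * Hausdorff premeasures *)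

Section HausdorffPre.
Variables (R : realType) (T : Type).
Implicit Types (d : T -> T -> R) (A : set T) (e : R).

Lemma diam_ge0 d A : (0 <= diam d A)%E.
Proof. by apply: ereal_sup_ubound; left. Qed.

Lemma diam_leP d A e : 0 <= e ->
  (forall x y, A x -> A y -> d x y <= e) <-> (diam d A <= e%:E)%E.
Proof.
move=> e0; split=> [dA|/ereal_supP dA x y Ax Ay].
  apply/ereal_supP => _ [->|[x Ax [y Ay <-]]]; first by rewrite lee_fin.
  by rewrite lee_fin dA.
by rewrite -lee_fin; apply: dA; right; exists x => //; exists y.
Qed.

Lemma le_diam d1 d2 A : (forall x y, d1 x y <= d2 x y) ->
  (diam d1 A <= diam d2 A)%E.
Proof.
move=> d12; apply/ereal_supP => _ [->|[x Ax [y Ay <-]]]; first exact: diam_ge0.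
apply: (@le_trans _ _ (d2 x y)%:E); first by rewrite lee_fin.
by apply: ereal_sup_ubound; right; exists x => //; exists y.
Qed.

Lemma diam0 d : diam d set0 = 0%E.
Proof.
apply/eqP; rewrite eq_le diam_ge0 andbT.
by apply/ereal_supP => _ [->|[x []]].
Qed.

Let term_ge0 d A : (0 <= (pi / 4)%:E * diam d A ^+ 2)%E.
Proof.
by rewrite mule_ge0 ?expe_ge0 ?diam_ge0// lee_fin divr_ge0 // pi_ge0.
Qed.

Lemma hausdorff2_pre_ge0 d e A : (0 <= hausdorff2_pre d e A)%E.
Proof.
by apply/ereal_infP => _ [C _ <-]; apply: nneseries_ge0 => i _ _; apply: term_ge0.
Qed.

Lemma le_hausdorff2_pre d e A B : A `<=` B ->
  (hausdorff2_pre d e A <= hausdorff2_pre d e B)%E.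
Proof.
move=> AB; apply: ereal_inf_le_tmp => _ [C [BC Ce] <-].
by exists C => //; split=> //; apply: subset_trans BC.
Qed.

Lemma hausdorff2_pre_le_metric d1 d2 e A : (forall x y, d1 x y <= d2 x y) ->
  (hausdorff2_pre d1 e A <= hausdorff2_pre d2 e A)%E.
Proof.
move=> d12; apply/ereal_infP => _ [C [AC Ce] <-].
apply: (@le_trans _ _ (\sum_(i <oo) (pi / 4)%:E * diam d1 (C i) ^+ 2)%E).
  apply: ereal_inf_lbound; exists C => //; split=> // i.
  by apply: le_trans (Ce i); apply: le_diam.
apply: lee_nneseries => [i _ _|i _]; first exact: term_ge0.
rewrite lee_wpmul2l ?lee_fin ?divr_ge0 ?pi_ge0//.
by rewrite !expe2 lee_pmul ?diam_ge0// le_diam.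
Qed.

Lemma hausdorff2_pre_anti d e1 e2 A : e1 <= e2 ->
  (hausdorff2_pre d e2 A <= hausdorff2_pre d e1 A)%E.
Proof.
move=> e12; apply: ereal_inf_le_tmp => _ [C [AC Ce] <-].
by exists C => //; split=> // i; apply: le_trans (Ce i) _; rewrite lee_fin.
Qed.

Lemma hausdorff2_pre_diam d e r A : 0 <= r <= e ->
  (forall x y, A x -> A y -> d x y <= r) ->
  (hausdorff2_pre d e A <= (pi / 4 * r ^+ 2)%:E)%E.
Proof.
move=> /andP[r0 re] /diam_leP-/(_ r0) Ar.
(* The cover is one set followed by empty ones, which cost nothing since their diameter is 0. *)
pose C i := if i is 0%N then A else set0.
apply: (@le_trans _ _ (\sum_(i <oo) (pi / 4)%:E * diam d (C i) ^+ 2)%E).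
  apply: ereal_inf_lbound; exists C => //; split=> [x Ax|[|i]]; first by exists 0%N.
  - by apply: le_trans Ar _; rewrite lee_fin.
  - by rewrite /= diam0 lee_fin (le_trans r0).
rewrite (nneseries_split 0 1); last by move=> i _; apply: term_ge0.
rewrite big_nat1 eseries0 ?adde0; last first.
  by move=> [|i] //= _ _; rewrite diam0 ?expe2 mul0e mule0.
rewrite [leRHS]EFinM lee_wpmul2l ?lee_fin ?divr_ge0 ?pi_ge0//.
by rewrite EFin_expe !expe2 lee_pmul ?diam_ge0.
Qed.

(** This merges two countable covers into one sequence. A partial sum of length [n] is at most the
    one of length [n.*2], which splits exactly. *)
Lemma nneseries_interleave_le (u v : (\bar R)^nat) :
  (forall n, 0 <= u n)%E -> (forall n, 0 <= v n)%E ->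
  (\sum_(i <oo) (if odd i then v i./2 else u i./2) <=
   \sum_(i <oo) u i + \sum_(i <oo) v i)%E.
Proof.
move=> u0 v0; set w := fun i => if odd i then v i./2 else u i./2.
have w0 i : (0 <= w i)%E by rewrite /w; case: ifP.
have w2 n : (\sum_(0 <= i < n.*2) w i =
    \sum_(0 <= i < n) u i + \sum_(0 <= i < n) v i)%E.
  elim: n => [|n IH]; first by rewrite !big_nil adde0.
  rewrite doubleS !big_nat_recr //= IH /w /= odd_double /= uphalf_double doubleK.
  by rewrite -!addeA; congr (_ + _)%E; rewrite addeCA.
apply: lime_le; first by apply: is_cvg_nneseries => i _ _; apply: w0.
apply: nearW => n.
apply: (@le_trans _ _ (\sum_(0 <= i < n) u i + \sum_(0 <= i < n) v i)%E).
  rewrite -w2; apply: (@lee_sum_nneg_natr _ w predT 0%N) => [i _ _|]; first exact: w0.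
  by rewrite -addnn leq_addr.
rewrite leeD// ?nneseries_lim_ge//.
Qed.

Lemma hausdorff2_preU d e A B :
  (hausdorff2_pre d e (A `|` B) <= hausdorff2_pre d e A + hausdorff2_pre d e B)%E.
Proof.
(* Covers within [k / 2] of the infimum are available when both infima are finite; otherwise the
   right side is infinite. *)
have [Aoo|] := eqVneq (hausdorff2_pre d e A) +oo%E.
  by rewrite Aoo addye ?leey// gt_eqF// (lt_le_trans _ (hausdorff2_pre_ge0 _ _ _)).
have [Boo _|Boo Aoo] := eqVneq (hausdorff2_pre d e B) +oo%E.
  by rewrite Boo addey ?leey// gt_eqF// (lt_le_trans _ (hausdorff2_pre_ge0 _ _ _)).
have fA : hausdorff2_pre d e A \is a fin_num.
  by rewrite ge0_fin_numE ?hausdorff2_pre_ge0 ?ltey.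
have fB : hausdorff2_pre d e B \is a fin_num.
  by rewrite ge0_fin_numE ?hausdorff2_pre_ge0 ?ltey.
apply/lee_addgt0Pr => k k0.
have k20 : 0 < k / 2 by rewrite divr_gt0.
have [_ [C [AC Ce] <-] Clt] := lb_ereal_inf_adherent k20 fA.
have [_ [D [BD De] <-] Dlt] := lb_ereal_inf_adherent k20 fB.
pose E i := if odd i then D i./2 else C i./2.
apply: (@le_trans _ _ (\sum_(i <oo) (pi / 4)%:E * diam d (E i) ^+ 2)%E).
  apply: ereal_inf_lbound; exists E => //; split=> [x [/AC[i _ Cx]|/BD[i _ Dx]]|i].
  - by exists i.*2 => //; rewrite /E odd_double doubleK.
  - by exists i.*2.+1 => //; rewrite /E /= odd_double /= uphalf_double.
  - by rewrite /E; case: ifP.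
apply: (@le_trans _ _ (\sum_(i <oo) (if odd i
    then (pi / 4)%:E * diam d (D i./2) ^+ 2
    else (pi / 4)%:E * diam d (C i./2) ^+ 2))%E).
  apply: lee_nneseries => [i _ _|i _]; first exact: term_ge0.
  by rewrite /E; case: ifP.
apply: le_trans (@nneseries_interleave_le
  (fun i => (pi / 4)%:E * diam d (C i) ^+ 2)%E
  (fun i => (pi / 4)%:E * diam d (D i) ^+ 2)%E
  (fun _ => term_ge0 _ _) (fun _ => term_ge0 _ _)) _.
rewrite [k in leRHS]splitr EFinD addeACA leeD // ltW//.
Qed.

(** A set of diameter at most [e] cannot meet both [A] and [B], so any cover splits into the sets
    meeting [A] and the others, which cover [B]. *)
Lemma hausdorff2_pre_separated d e A B :
  (forall x y, A x -> B y -> e < d x y) -> 0 <= e ->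
  (hausdorff2_pre d e A + hausdorff2_pre d e B <= hausdorff2_pre d e (A `|` B))%E.
Proof.
move=> sep e0; apply/ereal_infP => _ [C [ABC Ce] <-].
pose CA i := if `[< C i `&` A !=set0 >] then C i else set0.
pose CB i := if `[< C i `&` A !=set0 >] then set0 else C i.
have e0' : (0 <= e%:E)%E by rewrite lee_fin.
apply: (@le_trans _ _ (\sum_(i <oo) (pi / 4)%:E * diam d (CA i) ^+ 2 +
   \sum_(i <oo) (pi / 4)%:E * diam d (CB i) ^+ 2)%E).
  apply: leeD; apply: ereal_inf_lbound.
    exists CA => //; split=> [x Ax|i]; last by rewrite /CA; case: ifP => // _; rewrite diam0.
    have [i _ Cx] := ABC x (or_introl Ax); exists i => //.
    by rewrite /CA; case: ifPn => // /asboolP []; exists x.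
  exists CB => //; split=> [x Bx|i]; last by rewrite /CB; case: ifP => // _; rewrite diam0.
  have [i _ Cx] := ABC x (or_intror Bx); exists i => //.
  rewrite /CB; case: ifPn => // /asboolP [y [Cy Ay]].
  have /diam_leP-/(_ e0) /(_ y x Cy Cx) := Ce i.
  by rewrite leNgt sep.
rewrite -nneseriesD; [|by move=> *; apply: term_ge0..].
apply: lee_nneseries => [i _ _|i _]; first by rewrite adde_ge0 ?term_ge0.
have z0 : ((pi / 4 : R)%:E * 0 ^+ 2 = 0)%E by rewrite expe2 mul0e mule0.
by rewrite /CA /CB; case: ifP => _; rewrite diam0 z0 ?adde0 ?add0e.
Qed.

Lemma le_hausdorff2 d1 d2 A : (forall x y, d1 x y <= d2 x y) ->
  (hausdorff2 d1 A <= hausdorff2 d2 A)%E.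
Proof.
move=> d12; apply/ereal_supP => _ [e e0 <-].
apply: le_trans (hausdorff2_pre_le_metric _ _ d12) _.
by apply: ereal_sup_ubound; exists e.
Qed.

End HausdorffPre.

(** * Covering planar squares by discs *)

Definition square (R : realType) (c : R * R) (h : R) : set (R * R) :=
  [set p | `|p.1 - c.1| <= h /\ `|p.2 - c.2| <= h].

Definition rectangle (R : realType) (W H : R) : set (R * R) :=
  [set p | `|p.1| <= W /\ `|p.2| <= H].

(** The outer corner of the cell is tested, so an accepted cell lies entirely in the quarter disc of
    radius [M]. *)
Definition disc_cell (M : nat) : pred ('I_M * 'I_M) :=
  fun ij => (ij.1.+1 ^ 2 + ij.2.+1 ^ 2 <= M ^ 2)%N.

(* The proportion of cells of the [M * M] grid on the unit square that lie in
   the quarter disc centered at a corner. *)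
Definition disc_ratio (R : realType) (M : nat) : R :=
  #|@disc_cell M|%:R / M%:R ^+ 2.

(** Brackets are closed, so that the endpoint [t = M] can be put into the last cell. *)
Lemma ord_bracket (R : realType) (M : nat) (t : R) : 0 <= t <= M%:R -> (0 < M)%N ->
  exists i : 'I_M, i%:R <= t <= i.+1%:R.
Proof.
move=> /andP[t0 tM] M0; have [tltM|Mt] := ltP t M%:R.
  have /andP[tt tt1] := truncn_itv t0.
  have tM' : (Num.truncn t < M)%N by rewrite -(ltr_nat R) (le_lt_trans tt).
  by exists (Ordinal tM'); rewrite /= tt ltW.
have M1 : (M.-1 < M)%N by rewrite ltn_predL.
exists (Ordinal M1); rewrite /= prednK// tM andbT.
by rewrite (le_trans _ Mt)// ler_nat leq_pred.
Qed.

Section PlaneCover.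
(** [phi] stands for a Hausdorff premeasure transported to the plane by a chart; [e] bounds the
    diameters for which the chart is controlled. *)
Variables (R : realType) (phi : set (R * R) -> \bar R) (K e : R).
Hypotheses (K0 : 0 <= K)
  (phi_mono : forall A B, A `<=` B -> (phi A <= phi B)%E)
  (phiU : forall A B, (phi (A `|` B) <= phi A + phi B)%E)
  (phi_diam : forall A r, 0 <= r <= e ->
     (forall p q, A p -> A q -> (p.1 - q.1) ^+ 2 + (p.2 - q.2) ^+ 2 <= r ^+ 2) ->
     (phi A <= (K * r ^+ 2)%:E)%E).

Lemma phi_bigU (I : eqType) (s : seq I) (F : I -> set (R * R)) : 0 <= e ->
  (phi [set p | exists2 i, i \in s & F i p] <= \sum_(i <- s) phi (F i))%E.
Proof.
move=> e0; elim: s => [|i s IH].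
  rewrite big_nil; apply: le_trans (phi_diam (r := 0) _ _) _; rewrite ?lexx//.
    by move=> p q [].
  by rewrite expr0n/= mulr0.
rewrite big_cons; apply: le_trans (leeD (lexx _) IH).
apply: le_trans (phiU _ _); apply: phi_mono => p [j].
rewrite inE => /orP[/eqP-> Fp|js Fp]; first by left.
by right; exists j.
Qed.

(* The inscribed disc has diameter [2 * h], and the grid cells not inside it are
   again squares: the bound [k] improves to [1 + (1 - disc_ratio R M) * k],
   a contraction with fixed point [(disc_ratio R M)^-1]. *)
Lemma square_step (M : nat) (k h : R) (c : R * R) : (0 < M)%N -> 0 < h -> 2 * h <= e ->
  (forall c', (phi (square c' (h / (2 * M%:R))) <=
     (K * (4 * (h / (2 * M%:R)) ^+ 2 * k))%:E)%E) ->
  (phi (square c h) <=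
     (K * (4 * h ^+ 2 * (1 + (1 - disc_ratio R M) * k)))%:E)%E.
Proof.
move=> M0 h0 he Hk.
have MR0 : 0 < M%:R :> R by rewrite ltr0n.
pose disc : set (R * R) := [set p | (p.1 - c.1) ^+ 2 + (p.2 - c.2) ^+ 2 <= h ^+ 2].
(* A cell is a cell of the [M * M] grid of one quadrant together with the signs of the two
   coordinates; its half-side is [h / (2 * M)]. *)
pose sg (b : bool) : R := if b then -1 else 1.
pose I := (('I_M * 'I_M) * (bool * bool))%type.
pose cen (x : I) : R * R := (c.1 + sg x.2.1 * ((2 * x.1.1%:R + 1) * (h / (2 * M%:R))),
  c.2 + sg x.2.2 * ((2 * x.1.2%:R + 1) * (h / (2 * M%:R)))).
pose s : seq I := enum [pred x : I | ~~ disc_cell x.1].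
(* One coordinate at a time: the first bound places the point in its cell, the second compares it
   with the outer edge of the cell, which is what [disc_cell] tests. *)
have cell1 (x : R) : `|x| <= h -> exists (i : 'I_M) (b : bool),
    `|x - sg b * ((2 * i%:R + 1) * (h / (2 * M%:R)))| <= h / (2 * M%:R) /\
    x ^+ 2 <= i.+1%:R ^+ 2 * (h / M%:R) ^+ 2.
  move=> xh; pose t := `|x| * M%:R / h.
  have xt : `|x| = t * (h / M%:R) by rewrite /t; field; rewrite !gt_eqF.
  have t0 : 0 <= t <= M%:R.
    rewrite /t !mulr_ge0 ?invr_ge0 ?(ltW h0)//= ler_pdivrMr// mulrC.
    by rewrite ler_wpM2l.
  have [i /andP[it ti]] := ord_bracket t0 M0.
  exists i, (x < 0); split; last first.
    rewrite -exprMn -(real_normK (num_real x)) lerXn2r ?nnegrE ?mulr_ge0 ?invr_ge0 ?(ltW h0)//.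
    by rewrite xt ler_wpM2r// divr_ge0// ltW.
  have q0 : 0 < h / M%:R by rewrite divr_gt0.
  have -> : h / (2 * M%:R) = (h / M%:R) / 2 by field; rewrite gt_eqF.
  have e1 : `| `|x| - (2 * i%:R + 1) * (h / M%:R / 2)| <= h / M%:R / 2.
    rewrite xt; set q := h / M%:R in q0 *.
    rewrite -natr1 in ti; rewrite ler_norml; apply/andP; split; nra.
  apply: le_trans e1; have [x0|x0] := ltP x 0; rewrite /sg.
    by rewrite (ltr0_norm x0) mulN1r opprK -[X in X <= _]normrN opprD.
  by rewrite (ger0_norm x0) mul1r.
have sq_sub : square c h `<=` disc `|` [set p | exists2 i, i \in s &
    square (cen i) (h / (2 * M%:R)) p].
  move=> p [px py].
  have [i [b [ib i2]]] := cell1 _ px; have [j [b' [jb j2]]] := cell1 _ py.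
  have [good|bad] := boolP (disc_cell (i, j)).
    left; rewrite /disc /=; apply: le_trans (lerD i2 j2) _.
    rewrite -mulrDl; move: good; rewrite /disc_cell /= -(ler_nat R) natrD !natrX => good.
    apply: le_trans (ler_wpM2r (sqr_ge0 _) good) _.
    by rewrite -exprMn mulrCA divff ?mulr1// gt_eqF.
  right; exists ((i, j), (b, b')); first by rewrite mem_enum.
  by split; rewrite /cen /= opprD addrA.
apply: le_trans (phi_mono sq_sub) _; apply: le_trans (phiU _ _) _.
have e0 : 0 <= e by apply: le_trans he; rewrite mulr_ge0// ltW.
have ph1 : (phi disc <= (K * (2 * h) ^+ 2)%:E)%E.
  apply: phi_diam => [|p q]; first by rewrite he mulr_ge0// ltW.
  rewrite /disc /= => dp dq.
  set a := p.1 - c.1 in dp; set b := p.2 - c.2 in dp.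
  set a' := q.1 - c.1 in dq; set b' := q.2 - c.2 in dq.
  have -> : p.1 - q.1 = a - a' by rewrite /a /a'; ring.
  have -> : p.2 - q.2 = b - b' by rewrite /b /b'; ring.
  (* Parallelogram law: two vectors of norm at most [h] are at distance at most [2 * h]. *)
  have := sqr_ge0 (a + a'); have := sqr_ge0 (b + b'); nra.
apply: le_trans (leeD ph1 (phi_bigU s (fun x => square (cen x) (h / (2 * M%:R))) e0)) _.
apply: (@le_trans _ _ ((K * (2 * h) ^+ 2)%:E +
    \sum_(i <- s) (K * (4 * (h / (2 * M%:R)) ^+ 2 * k))%:E)%E).
  by rewrite leeD2l// lee_sum.
rewrite sumEFin -EFinD lee_fin big_const_seq count_predT iter_addr_0.
have -> : size s = (4 * (M ^ 2 - #|@disc_cell M|))%N.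
  rewrite /s -cardE.
  have -> : #|[pred x : I | ~~ disc_cell x.1]| =
      #|[predX [predC @disc_cell M] & [pred b : bool * bool | true]]|.
    by apply: eq_card => -[x y]; rewrite !inE /= andbT.
  rewrite cardX mulnC; congr (_ * _)%N; first by rewrite card_prod card_bool.
  have := cardC (@disc_cell M); rewrite card_prod !card_ord mulnn => <-.
  by rewrite addKn.
have dM : (#|@disc_cell M| <= M ^ 2)%N.
  by rewrite (leq_trans (max_card _))// card_prod !card_ord.
rewrite -[_ *+ (4 * _)]mulr_natr natrM natrB// natrX /disc_ratio.
rewrite le_eqVlt; apply/orP; left; apply/eqP; field.
by rewrite gt_eqF.
Qed.

(** The initial value 2 is the ratio of the squared diagonal [8 * h ^ 2] of a square to its area
    [4 * h ^ 2]. *)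
Definition cover_factor (M n : nat) : R :=
  iter n (fun k => 1 + (1 - disc_ratio R M) * k) 2.

(** The condition [3 * h <= e] admits the whole square, of diagonal [Num.sqrt 8 * h], as a starting
    cover, and passes to the smaller squares of the induction. *)
Lemma square_iter (M n : nat) (h : R) (c : R * R) : (0 < M)%N -> 0 < h -> 3 * h <= e ->
  (phi (square c h) <= (K * (4 * h ^+ 2 * cover_factor M n))%:E)%E.
Proof.
move=> M0; elim: n c h => [|n IH] c h h0 he.
  have -> : 4 * h ^+ 2 * cover_factor M 0 = (Num.sqrt 8 * h) ^+ 2.
    rewrite exprMn sqr_sqrtr//; rewrite /cover_factor/=; ring.
  apply: phi_diam => [|p q].
    rewrite mulr_ge0 ?sqrtr_ge0 ?(ltW h0)//=; apply: le_trans he.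
    rewrite ler_wpM2r ?(ltW h0)// -[leRHS]gtr0_norm// -sqrtr_sqr ler_sqrt//.
    by rewrite -natrX ler_nat.
  move=> [+ +] [+ +]; rewrite !ler_norml => /andP[p1 p2] /andP[p3 p4].
  move=> /andP[q1 q2] /andP[q3 q4]; rewrite exprMn sqr_sqrtr//.
  set a := p.1 in p1 p2 *; set b := p.2 in p3 p4 *.
  set a' := q.1 in q1 q2 *; set b' := q.2 in q3 q4 *.
  have A : (a - a') ^+ 2 <= 4 * h ^+ 2 by nra.
  have B : (b - b') ^+ 2 <= 4 * h ^+ 2 by nra.
  nra.
apply: square_step => //.
  apply: le_trans he; nra.
have M1 : 1 <= M%:R :> R by rewrite ler1n.
move=> c'; apply: IH; first by rewrite divr_gt0// mulr_gt0// ltr0n.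
apply: le_trans he; rewrite ler_wpM2l// ler_pdivrMr; nra.
Qed.

Lemma disc_ratio_le1 M : disc_ratio R M <= 1.
Proof.
case: M => [|M]; first by rewrite /disc_ratio expr0n /= invr0 mulr0.
rewrite /disc_ratio ler_pdivrMr ?exprn_gt0// mul1r -natrX ler_nat.
by rewrite (leq_trans (max_card _))// card_prod !card_ord.
Qed.

(** As the number of disc steps grows, the factor in [square_iter] tends to its fixed point; each
    step involves finitely many sets only. *)
Lemma square_le (M : nat) (h : R) (c : R * R) : 0 < disc_ratio R M -> 0 < h -> 3 * h <= e ->
  (phi (square c h) <= (K / disc_ratio R M * (2 * h) ^+ 2)%:E)%E.
Proof.
move=> B0 h0 he; set B := disc_ratio R M in B0 *.
have M0 : (0 < M)%N.
  by case: (posnP M) B0 => // M0; rewrite /B /disc_ratio M0 expr0n /= invr0 mulr0 ltxx.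
have B1 : B <= 1 by apply: disc_ratio_le1.
(* Closed form of the affine recursion: the distance to the fixed point is multiplied by [1 - B] at
   each step. *)
have kE n : cover_factor M n = B^-1 + (1 - B) ^+ n * (2 - B^-1).
  elim: n => [|n IH]; first by rewrite expr0 /cover_factor /=; ring.
  by rewrite /cover_factor iterS -/(cover_factor M n) IH exprS -/B; field; rewrite gt_eqF.
pose C := K * (2 * h) ^+ 2 * 2.
have C0 : 0 <= C by rewrite !mulr_ge0// ltW.
apply/lee_addgt0Pr => k k0.
have /cvgrPdist_lt /(_ (k / (C + 1))) : (fun n => (1 - B) ^+ n) @ \oo --> (0 : R).
  apply: cvg_expr; rewrite ger0_norm; lra.
have kC : 0 < k / (C + 1) by rewrite divr_gt0//; lra.
move=> /(_ kC) [n _ /(_ n (leqnn n))]; rewrite /= sub0r normrN => Bn.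
apply: le_trans (square_iter n c M0 h0 he) _.
rewrite -EFinD lee_fin kE.
have B'0 : 0 < B^-1 by rewrite invr_gt0.
have Bn0 : 0 <= (1 - B) ^+ n by apply: exprn_ge0; lra.
move: Bn; rewrite ger0_norm// ltr_pdivlMr; last by lra.
set q := (1 - B) ^+ n in Bn0 * => qk.
have -> : K * (4 * h ^+ 2 * (B^-1 + q * (2 - B^-1))) =
  K / B * (2 * h) ^+ 2 + q * C - (K * (2 * h) ^+ 2) * (q * B^-1).
  by rewrite /C; field; rewrite gt_eqF.
have : 0 <= (K * (2 * h) ^+ 2) * (q * B^-1) by rewrite !mulr_ge0 ?(ltW B'0) ?(ltW h0).
nra.
Qed.

(** Rounding up the number of squares along a side lengthens that side by at most one square, that
    is [2 * h]. *)
Lemma rectangle_grid_le (M : nat) (h W H : R) : 0 < disc_ratio R M -> 0 < h -> 3 * h <= e ->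
  0 <= W -> 0 <= H ->
  (phi (rectangle W H) <=
    (K / disc_ratio R M * ((2 * W + 2 * h) * (2 * H + 2 * h)))%:E)%E.
Proof.
move=> B0 h0 he W0 H0.
have grid (L : R) : 0 <= L -> exists2 n : nat, 2 * h * n%:R <= 2 * L + 2 * h &
    forall x, `|x| <= L -> exists i : 'I_n, `|x - (- L + (2 * i%:R + 1) * h)| <= h.
  move=> L0; have Lh : 0 <= L / h by rewrite divr_ge0// ltW.
  have /andP[nl nu] := truncn_itv Lh; set n := Num.truncn _ in nl nu.
  exists n.+1.
    by rewrite -natr1; move: nl; rewrite ler_pdivlMr//; nra.
  move=> x xL; have t0 : 0 <= (x + L) / (2 * h) <= n.+1%:R.
    move: xL; rewrite ler_norml => /andP[x1 x2].
    rewrite divr_ge0 /=; [|lra|lra].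
    rewrite ler_pdivrMr; last lra.
    by move: nu; rewrite ltr_pdivrMr//; nra.
  have [i /andP[]] := ord_bracket t0 isT.
  rewrite ler_pdivlMr ?ler_pdivrMr; [|lra|lra] => i1; rewrite -natr1 => i2.
  by exists i; rewrite ler_norml; apply/andP; split; lra.
have [n nW nP] := grid W W0; have [m mH mP] := grid H H0.
pose cen (x : 'I_n * 'I_m) : R * R :=
  (- W + (2 * x.1%:R + 1) * h, - H + (2 * x.2%:R + 1) * h).
have sub : rectangle W H `<=` [set p | exists2 i, i \in enum {: 'I_n * 'I_m} &
    square (cen i) h p].
  move=> p [/nP[i ip] /mP[j jp]]; exists (i, j); first by rewrite mem_enum.
  by split.
apply: le_trans (phi_mono sub) _.
have e0 : 0 <= e by apply: le_trans he; rewrite mulr_ge0// ltW.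
apply: le_trans (phi_bigU (enum {: 'I_n * 'I_m}) (fun i => square (cen i) h) e0) _.
apply: (@le_trans _ _ (\sum_(i <- enum {: 'I_n * 'I_m})
    (K / disc_ratio R M * (2 * h) ^+ 2)%:E)%E).
  by apply: lee_sum => i _; apply: square_le.
rewrite sumEFin lee_fin big_const_seq count_predT iter_addr_0 -cardE card_prod !card_ord.
rewrite -[_ *+ (n * m)]mulr_natr -[leLHS]mulrA ler_wpM2l ?divr_ge0 ?(ltW B0)// natrM.
have -> : (2 * h) ^+ 2 * (n%:R * m%:R) = (2 * h * n%:R) * (2 * h * m%:R) by ring.
by apply: ler_pM => //; rewrite !mulr_ge0// ltW.
Qed.

Lemma rectangle_le (M : nat) (W H : R) : 0 < disc_ratio R M -> 0 < e ->
  0 <= W -> 0 <= H ->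
  (phi (rectangle W H) <= (K / disc_ratio R M * (4 * W * H))%:E)%E.
Proof.
move=> B0 e0 W0 H0; apply/lee_addgt0Pr => k k0.
set C := K / disc_ratio R M.
have C0 : 0 <= C by rewrite divr_ge0// ltW.
(* For [h <= 1], [D] bounds the coefficient of [h] in the excess caused by rounding. *)
pose D := C * (4 * W + 4 * H + 4).
have D0 : 0 <= D by rewrite mulr_ge0//; lra.
pose h := Num.min (e / 3) (Num.min 1 (k / (D + 1))).
have h0 : 0 < h by rewrite !lt_min !divr_gt0//=; lra.
have he : 3 * h <= e.
  have : h <= e / 3 by rewrite ge_min lexx.
  by lra.
have h1 : h <= 1 by rewrite !ge_min lexx orbT.
have hk : h * (D + 1) <= k.
  by rewrite -ler_pdivlMr; [rewrite !ge_min lexx !orbT|lra].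
apply: le_trans (rectangle_grid_le B0 h0 he W0 H0) _.
rewrite -EFinD lee_fin -/C.
have -> : C * ((2 * W + 2 * h) * (2 * H + 2 * h)) =
  C * (4 * W * H) + h * (C * (4 * W + 4 * H + 4 * h)) by ring.
have : C * (4 * W + 4 * H + 4 * h) <= D by rewrite /D ler_wpM2l//; lra.
nra.
Qed.

End PlaneCover.

(** Row [i] contains all cells [j] with [j.+1] at most the square root; rounding down loses less
    than one cell. *)
Lemma disc_row (R : realType) (M : nat) (i : 'I_M) :
  Num.sqrt (M%:R ^+ 2 - i.+1%:R ^+ 2) - 1 <=
    #|[pred j : 'I_M | disc_cell (i, j)]|%:R :> R.
Proof.
set y := Num.sqrt _.
have y0 : 0 <= y by apply: sqrtr_ge0.
have /andP[my ym] := truncn_itv y0; set m := Num.truncn y in my ym.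
have iM : i.+1%:R <= M%:R :> R by rewrite ler_nat.
have y2 : y ^+ 2 = M%:R ^+ 2 - i.+1%:R ^+ 2.
  by rewrite sqr_sqrtr// subr_ge0 lerXn2r// nnegrE.
have mM : (m <= M)%N.
  have m0 : 0 <= m%:R :> R by [].
  have M0 : 0 <= M%:R :> R by [].
  rewrite -(ler_nat R); have := sqr_ge0 (i.+1%:R : R); nra.
apply: (@le_trans _ _ m%:R).
  by rewrite lerBlDr natr1 ltW.
rewrite ler_nat.
rewrite -[m in (m <= _)%N]card_ord -(card_codom (f := widen_ord mM)); last first.
  by move=> x x' /(congr1 val) /= /val_inj.
apply: subset_leq_card; apply/fintype.subsetP => j /codomP[x ->].
rewrite inE /disc_cell /= -(ler_nat R) natrD !natrX.
have : x.+1%:R <= m%:R :> R by rewrite ler_nat.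
have x0 : 0 <= x.+1%:R :> R by [].
nra.
Qed.

(** Of the 2 subtracted, one is the term [k = 0], which a sum over right endpoints lacks, and the
    other is the rounding loss of [disc_row] over [M] rows. *)
Lemma disc_ratio_ge (R : realType) (M : nat) : (0 < M)%N ->
  M%:R^-1 * (\sum_(k < M) Num.sqrt (1 - (k%:R / M%:R) ^+ 2) - 2) <= disc_ratio R M.
Proof.
move=> M0; have MR : 0 < M%:R :> R by rewrite ltr0n.
rewrite /disc_ratio ler_pdivlMr ?exprn_gt0//.
have -> : #|@disc_cell M|%:R = \sum_(i < M) #|[pred j : 'I_M | disc_cell (i, j)]|%:R :> R.
  rewrite -natr_sum; congr _%:R; rewrite -sum1_card.
  rewrite (eq_bigr (fun i : 'I_M => \sum_(j < M | disc_cell (i, j)) 1)%N).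
    by rewrite pair_big_dep /=; apply: eq_bigl => -[].
  by move=> i _; rewrite sum1_card.
apply: le_trans (ler_sum _ (fun i _ => disc_row R i)).
rewrite sumrB sumr_const card_ord.
case: M M0 MR => // M _ MR.
rewrite [X in _ <= X - _]big_ord_recr /= subrr sqrtr0 addr0.
rewrite big_ord_recl /= mul0r expr0n /= subr0 sqrtr1.
have -> : \sum_(i < M) Num.sqrt (M.+1%:R ^+ 2 - i.+1%:R ^+ 2) =
   M.+1%:R * \sum_(i < M) Num.sqrt (1 - ((bump 0 i)%:R / M.+1%:R) ^+ 2) :> R.
  rewrite mulr_sumr; apply: eq_bigr => i _; rewrite /bump leq0n add1n.
  rewrite -[X in X * _](ger0_norm (ltW MR)) -sqrtr_sqr -sqrtrM ?sqr_ge0//.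
  by congr Num.sqrt; field; rewrite gt_eqF.
set S := \sum_(i < M) _.
rewrite le_eqVlt; apply/orP; left; apply/eqP; field; by rewrite gt_eqF.
Qed.

(** The left side is a Riemann sum over [[0, t]] only. For large [M] the missing terms between [n]
    and [M] add up to more than the 2 lost in [disc_ratio_ge]. This strict gap drives the rigidity
    argument. *)
Lemma disc_ratio_gt (R : realType) (t : R) : 0 <= t < 1 ->
  exists M n : nat, [/\ (0 < M)%N, t * M%:R <= n%:R &
    M%:R^-1 * \sum_(k < n) Num.sqrt (1 - (k%:R / M%:R) ^+ 2) < disc_ratio R M].
Proof.
(* The missing terms sum to at least [(M - n) ^ 2 / (2 * M)] with [M - n >= M * (1 - t) / 2], hence
   to at least [M * (1 - t) ^ 2 / 8], and 16 makes this exceed 2. *)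
move=> /andP[t0 t1]; pose M := (Num.truncn (16 / (1 - t) ^+ 2)).+1.
have T0 : 0 < (1 - t) ^+ 2 by rewrite exprn_gt0// subr_gt0.
have MR : 0 < M%:R :> R by rewrite ltr0n.
have Mt : 16 < M%:R * (1 - t) ^+ 2.
  rewrite -ltr_pdivrMr//; have /truncn_itv/andP[] // : 0 <= 16 / (1 - t) ^+ 2.
  by rewrite divr_ge0// ltW.
have tM0 : 0 <= t * M%:R by rewrite mulr_ge0.
have /andP[] := truncn_itv tM0; set n0 := Num.truncn _ => nt tn.
pose n := n0.+1; have nt1 : n%:R <= t * M%:R + 1 by rewrite /n -natr1; lra.
have Mt2 : 4 < M%:R * (1 - t).
  have : (1 - t) ^+ 2 <= (1 - t) by nra.
  nra.
have nM : (n <= M)%N by rewrite -(ler_nat R); lra.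
exists M, n; split=> //; first exact: ltW.
apply: lt_le_trans (disc_ratio_ge R (M := M) isT).
rewrite ltr_pM2l ?invr_gt0// ltrBrDr.
rewrite -(big_mkord xpredT (fun k => Num.sqrt (1 - (k%:R / M%:R) ^+ 2))).
rewrite -(big_mkord xpredT (fun k => Num.sqrt (1 - (k%:R / M%:R) ^+ 2))).
rewrite [ltRHS](big_cat_nat (n := n))//= ltrD2l.
(* A primitive of [1 - k / M] in [k]: its increments telescope and lie below
   [1 - x <= sqrt (1 - x ^ 2)]. *)
pose g k : R := - (M%:R - k%:R) ^+ 2 / (2 * M%:R).
apply: (@lt_le_trans _ _ (\sum_(n <= k < M) (g k.+1 - g k))).
  rewrite telescope_sumr// /g subrr expr0n /= oppr0 mul0r sub0r -mulNr opprK.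
  rewrite ltr_pdivlMr ?mulr_gt0//.
  have : M%:R * (1 - t) / 2 <= M%:R - n%:R by lra.
  nra.
apply: ler_sum_nat => k /andP[_ kM].
have kMR : k.+1%:R <= M%:R :> R by rewrite ler_nat.
set x := k%:R / M%:R.
have x01 : 0 <= x <= 1.
  by rewrite divr_ge0//= ler_pdivrMr// mul1r (le_trans _ kMR)// ler_nat.
move/andP: x01 => [x0 x1].
apply: (@le_trans _ _ (1 - x)).
  rewrite /g /x -natr1 -subr_ge0.
  have -> : 1 - k%:R / M%:R - (- (M%:R - (k%:R + 1)) ^+ 2 / (2 * M%:R)
     - - (M%:R - k%:R) ^+ 2 / (2 * M%:R)) = (2 * M%:R)^-1 :> R.
    by field; rewrite gt_eqF.
  by rewrite invr_ge0 mulr_ge0// ltW.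
have y0 : 0 <= 1 - x ^+ 2 by nra.
rewrite -[leLHS]ger0_norm ?subr_ge0// -sqrtr_sqr ler_wsqrtr//; nra.
Qed.

(** * The row inequality *)

(* A Riemann sum, of mesh [h], for the integral of [sqrt (1 - (s x) ^ 2)] over
   [0, 1] when [n * h] is about 1. *)
Definition weight_sum (R : realType) (s h : R) (n : nat) : R :=
  h * \sum_(k < n) Num.sqrt (1 - (s * h * k%:R) ^+ 2).

Section RowInequality.
Variables (R : realType) (F : R -> R -> R) (A : nat -> set (R * R)) (r : nat -> R).
Variables (l b a s h : R) (n : nat).
Hypotheses (l0 : 0 <= l) (b0 : 0 <= b) (a0 : 0 <= a) (s0 : 0 <= s) (h0 : 0 < h)
  (nh1 : 1 <= n%:R * h) (r0 : forall i, 0 <= r i)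
  (F_cont : forall v, `|v| <= b -> {within `[- l, l], continuous (F ^~ v)})
  (F_incr : forall v, `|v| <= b -> a * (2 * l) <= F l v - F (- l) v)
  (A_cover : forall u v, `|u| <= l -> `|v| <= b -> exists i, A i (u, v))
  (A_diam : forall i p q, A i p -> A i q ->
     (p.1 - q.1) ^+ 2 + (p.2 - q.2) ^+ 2 <= r i ^+ 2)
  (A_osc : forall i p q, A i p -> A i q -> F p.1 p.2 - F q.1 q.2 <= r i)
  (F_lip : forall i u u' v, A i (u, v) -> A i (u', v) ->
     s * (F u v - F u' v) <= `|u - u'|).

Let level (i k : nat) : set R := [set v | exists u u',
  [/\ A i (u, v), A i (u', v) & k%:R * h * r i < F u' v - F u v]].

Let width (k : nat) : R := Num.sqrt (1 - (s * h * k%:R) ^+ 2).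

(* The rows reaching level [k] contain pairs at horizontal distance at least
   [t = s k h r]; in any two of them some pair of points is that far apart
   horizontally, which leaves at most [sqrt (r ^ 2 - t ^ 2)] vertically. *)
Let level_diam i k v v' : level i k v -> level i k v' -> `|v - v'| <= r i * width k.
Proof.
move=> [a1 [b1 [Aa1 Ab1 F1]]] [a2 [b2 [Aa2 Ab2 F2]]].
set t := s * h * k%:R * r i.
have t0 : 0 <= t by rewrite !mulr_ge0// ltW.
have t1 : t <= `|b1 - a1|.
  by apply: le_trans (F_lip Ab1 Aa1); rewrite /t -!mulrA ler_wpM2l// ltW// mulrCA mulrA.
have t2 : t <= `|b2 - a2|.
  by apply: le_trans (F_lip Ab2 Aa2); rewrite /t -!mulrA ler_wpM2l// ltW// mulrCA mulrA.
have := A_diam Aa1 Aa2; have := A_diam Aa1 Ab2.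
have := A_diam Ab1 Aa2; have := A_diam Ab1 Ab2; rewrite /=.
set w := (v - v') ^+ 2 => h1 h2 h3 h4.
have wt : w <= r i ^+ 2 * (1 - (s * h * k%:R) ^+ 2).
  rewrite mulrBr mulr1 -exprMn [r i * _]mulrC -/t.
  (* For equal signs, [(b1 - a2) + (b2 - a1) = (b1 - a1) + (b2 - a2)], so one of the two cross
     differences is at least [t]; opposite signs exchange the roles of [a2] and [b2]. *)
  move: t1 t2; rewrite !ler_normr => /orP[] t1 /orP[] t2.
  - have [x|x] := leP t (b1 - a2); [nra|].
    have : t <= b2 - a1 by lra.
    by move=> ?; nra.
  - have [x|x] := leP t (b1 - b2); [nra|].
    have : t <= a2 - a1 by lra.
    by move=> ?; nra.
  - have [x|x] := leP t (a1 - a2); [nra|].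
    have : t <= b2 - b1 by lra.
    by move=> ?; nra.
  - have [x|x] := leP t (a1 - b2); [nra|].
    have : t <= a2 - b1 by lra.
    by move=> ?; nra.
rewrite -sqrtr_sqr -/w (le_trans (ler_wsqrtr wt))//.
by rewrite sqrtrM ?sqr_ge0// sqrtr_sqr ger0_norm.
Qed.

(** A level set may fail to be measurable; an interval of the length allowed by [level_diam]
    replaces it. *)
Let slab (i k : nat) : set R :=
  `[inf (level i k), inf (level i k) + r i * width k]%classic.

Let level_slab i k : level i k `<=` slab i k.
Proof.
move=> v lv; rewrite /slab /= in_itv /=.
have lb v' : level i k v' -> v - r i * width k <= v'.
  move=> lv'; have := level_diam lv lv'; rewrite ler_norml; lra.
rewrite ge_inf//=; last by exists (v - r i * width k).
have : v - r i * width k <= inf (level i k) by apply: lb_le_inf => //; exists v.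
by lra.
Qed.

Let slab_measure i k : lebesgue_measure (slab i k) = (r i * width k)%:E.
Proof.
have w0 : 0 <= r i * width k by rewrite mulr_ge0 ?sqrtr_ge0.
rewrite lebesgue_measure_itv /= lte_fin ltrDl -EFinB addrAC subrr add0r.
by case: ltP => // w0'; congr EFin; apply/eqP; rewrite eq_le w0 w0'.
Qed.

Let osc (i : nat) (v : R) : R := h * r i * \sum_(k < n) \1_(slab i k) v.

Let osc_ge0 i v : 0 <= osc i v.
Proof.
by rewrite /osc !mulr_ge0 ?(ltW h0)// sumr_ge0// => k _; rewrite indicE.
Qed.

(** Layer cake: each level [k] with [k * h * r i < D] contributes [h * r i], and
    [D <= r i <= n * h * r i] means that [n] levels exhaust [D]. *)
Let row_osc i u u' v : A i (u, v) -> A i (u', v) -> F u' v - F u v <= osc i v.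
Proof.
move=> Au Au'; set D := F u' v - F u v.
have Dr : D <= r i by apply: (A_osc Au' Au).
have key m : (m <= n)%N -> Num.min D (m%:R * (h * r i)) <=
    h * r i * \sum_(k < m) \1_(slab i k) v.
  elim: m => [|m IH] mn; first by rewrite big_ord0 mulr0 mul0r ge_min lexx orbT.
  rewrite big_ord_recr /= mulrDr.
  have [mD|Dm] := ltP (m%:R * h * r i) D.
    have lv : \1_(slab i m) v = 1 :> R.
      by rewrite indicE mem_set//; apply: level_slab; exists u, u'.
    rewrite lv mulr1 -natr1 mulrDl mul1r.
    apply: le_trans (_ : Num.min D (m%:R * (h * r i)) + h * r i <= _); last first.
      by rewrite lerD2r IH// ltnW.
    by rewrite !mulrA (min_r (ltW mD)) ge_min lexx orbT.
  apply: (@le_trans _ _ (Num.min D (m%:R * (h * r i)))).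
    by rewrite [m%:R * _]mulrA (min_l Dm) ge_min lexx.
  rewrite (le_trans (IH (ltnW mn)))// lerDl !mulr_ge0 ?(ltW h0)//.
rewrite /osc; apply: le_trans (key n (leqnn n)).
rewrite le_min lexx mulrA (le_trans Dr)// -[leLHS]mul1r ler_wpM2r//.
Qed.

(** By the intermediate value theorem the values of [F] along the row fill [[F (- l) v, F l v]];
    they are covered by one interval of length [osc i v] for each [i], and Lebesgue measure is
    subadditive. *)
Let row_le v : `|v| <= b -> ((a * (2 * l))%:E <= \sum_(i <oo) (osc i v)%:E)%E.
Proof.
move=> vb; have Fl := F_incr vb.
have Fle : F (- l) v <= F l v.
  by rewrite -subr_ge0 (le_trans _ Fl)// !mulr_ge0.
pose E i : set R := [set F u v | u in [set u | A i (u, v)]].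
pose I i : set R := `[inf (E i), inf (E i) + osc i v]%classic.
have EI i : E i `<=` I i.
  move=> _ [u Au <-]; rewrite /I /= in_itv /=.
  have lb y : E i y -> F u v - osc i v <= y.
    by move=> [u' Au' <-]; have := row_osc Au' Au; lra.
  rewrite ge_inf//=; [|by exists (F u v - osc i v)|by exists u].
  have : F u v - osc i v <= inf (E i) by apply: lb_le_inf => //; exists (F u v), u.
  by lra.
have mI i : lebesgue_measure (I i) = (osc i v)%:E.
  rewrite lebesgue_measure_itv /= lte_fin ltrDl -EFinB addrAC subrr add0r.
  by case: ltP => // w0'; congr EFin; apply/eqP; rewrite eq_le osc_ge0 w0'.
have sub : `[F (- l) v, F l v]%classic `<=` \bigcup_i I i.
  move=> y /=; rewrite in_itv /= => yF.
  have ll : - l <= l by rewrite (le_trans _ l0)// oppr_le0.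
  have [|u] := IVT (v := y) ll (F_cont vb).
    by rewrite (min_l Fle) (max_r Fle).
  rewrite in_itv /= -ler_norml => ul <-.
  by have [i Ai] := A_cover ul vb; exists i => //; apply: EI; exists u.
apply: (@le_trans _ _ (lebesgue_measure (`[F (- l) v, F l v]%classic : set R))).
  rewrite lebesgue_measure_itv /= lte_fin -EFinB.
  case: ltP => FF; rewrite lee_fin// (le_trans Fl)// subr_le0//.
apply: le_trans (measure_sigma_subadditive (@lebesgue_measure R) _ _ sub) _ => //.
  by move=> i; apply: measurable_itv.
by rewrite le_eqVlt; apply/orP; left; apply/eqP; apply: eq_eseriesr => i _; rewrite -mI.
Qed.

(** Integrate [row_le] over the rows and exchange sum and integral: the slabs of [A i] have total
    weighted length [r i ^ 2 * weight_sum s h n]. *)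
Lemma row_inequality :
  ((a * (2 * l) * (2 * b))%:E <= \sum_(i <oo) (r i ^+ 2 * weight_sum s h n)%:E)%E.
Proof.
have mosc i : measurable_fun [set: R] (fun v : R => (osc i v)%:E).
  apply/measurable_EFinP; apply: measurable_funM => //.
  apply: measurable_sum => k; apply: measurable_indic; exact: measurable_itv.
pose B : set R := `[- b, b]%classic.
have mb : measurable B by apply: measurable_itv.
have mB : lebesgue_measure B = ((2 * b)%R)%:E.
  apply: etrans (lebesgue_measure_itv `[- b, b]%R) _.
  rewrite /= lte_fin -EFinB; case: ltP => bb; first by congr EFin; ring.
  have b00 : b = 0 by apply/eqP; rewrite eq_le b0 andbT (le_trans bb)// oppr_le0.
  by rewrite b00 mulr0.
apply: (@le_trans _ _
    (\int[lebesgue_measure]_(v in B) (a * (2 * l))%:E)%E).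
  by rewrite integral_cst// [X in (_ * X)%E]mB -EFinM.
apply: (@le_trans _ _
    (\int[lebesgue_measure]_(v in B) \sum_(i <oo) (osc i v)%:E)%E).
  apply: ge0_le_integral => //.
  - by move=> v _; rewrite lee_fin !mulr_ge0.
  - apply: ge0_emeasurable_sum => [i v _ _|i _]; first by rewrite lee_fin.
    by apply: measurable_funTS; apply: mosc.
  - by move=> v; rewrite /B /= in_itv /= -ler_norml; apply: row_le.
rewrite integral_nneseries//; last 2 first.
- by move=> i; apply: measurable_funTS; apply: mosc.
- by move=> i v _; rewrite lee_fin.
apply: lee_nneseries => [i _ _|i _].
  by apply: integral_ge0 => v _; rewrite lee_fin.
(* Slabs may stick out of [[- b, b]]; over the whole line each one counts with its full length. *)
apply: (@le_trans _ _ (\int[lebesgue_measure]_(v in [set: R]) (osc i v)%:E)%E).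
  apply: ge0_subset_integral; [exact: mb|exact: measurableT|exact: mosc| |by []].
  by move=> v _; rewrite lee_fin.
under eq_integral do rewrite /osc EFinM -sumEFin.
rewrite ge0_integralZl//; last 3 first.
- apply: emeasurable_sum => k; apply/measurable_EFinP.
  by apply: measurable_indic; exact: measurable_itv.
- by move=> v _; apply: sume_ge0 => k _; rewrite lee_fin indicE.
- by rewrite lee_fin mulr_ge0// ltW.
rewrite ge0_integral_sum//; last first.
  move=> k; apply/measurable_EFinP.
  by apply: measurable_indic; exact: measurable_itv.
rewrite (eq_bigr (fun k : 'I_n => (r i * width k)%:E)); last first.
  move=> k _; apply: etrans (integral_indic _ _ _) _.
  - exact: measurableT.
  - exact: measurable_itv.
  - by rewrite setIT; exact: slab_measure.
rewrite sumEFin -EFinM lee_fin -mulr_sumr /weight_sum.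
by rewrite le_eqVlt; apply/orP; left; apply/eqP; rewrite /width; ring.
Qed.

End RowInequality.

(** * Chords and angles *)

Section Euclid.
Variable R : realType.
Implicit Types (v w : 'rV[R]_3) (x y z : S2 R).

Definition dot v w : R := \sum_(i < 3) v 0 i * w 0 i.

Definition chord x y : R := eucl_norm (\val x - \val y).

Lemma sum_ord3 (F : 'I_3 -> R) : \sum_(i < 3) F i = F 0 + F 1 + F 2.
Proof.
rewrite !big_ord_recr big_ord0 /= add0r.
by congr (F _ + F _ + F _); apply: val_inj.
Qed.

Lemma dotE v w : dot v w = v 0 0 * w 0 0 + v 0 1 * w 0 1 + v 0 2 * w 0 2.
Proof. exact: sum_ord3. Qed.

Lemma eucl_normE v : eucl_norm v = Num.sqrt (dot v v).
Proof. by congr Num.sqrt; apply: eq_bigr => i _; rewrite expr2. Qed.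

Lemma dot_ge0 v : 0 <= dot v v.
Proof. by rewrite dotE -!expr2 !addr_ge0 ?sqr_ge0. Qed.

Lemma eucl_norm_ge0 v : 0 <= eucl_norm v. Proof. exact: sqrtr_ge0. Qed.

Lemma eucl_norm_sqr v : eucl_norm v ^+ 2 = dot v v.
Proof. by rewrite eucl_normE sqr_sqrtr// dot_ge0. Qed.

Lemma dot_le v w : dot v w <= eucl_norm v * eucl_norm w.
Proof.
rewrite !eucl_normE -sqrtrM ?dot_ge0//; apply: le_trans (ler_norm _) _.
rewrite -sqrtr_sqr; apply: ler_wsqrtr; rewrite !dotE -subr_ge0.
set a := v 0 0; set b := v 0 1; set c := v 0 2.
set a' := w 0 0; set b' := w 0 1; set c' := w 0 2.
(* Lagrange's identity. *)
have -> : (a * a + b * b + c * c) * (a' * a' + b' * b' + c' * c') -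
  (a * a' + b * b' + c * c') ^+ 2 = (a * b' - b * a') ^+ 2 +
  (a * c' - c * a') ^+ 2 + (b * c' - c * b') ^+ 2 by ring.
by rewrite !addr_ge0 ?sqr_ge0.
Qed.

Lemma dot_val x : dot (\val x) (\val x) = 1.
Proof.
have : unit_sphere (\val x) := set_valP x.
by rewrite /unit_sphere /= => ux; rewrite -eucl_norm_sqr ux expr1n.
Qed.

Lemma S2_of v : dot v v = 1 -> exists x, \val x = v.
Proof.
move=> v1; have uv : unit_sphere v by rewrite /unit_sphere /= eucl_normE v1 sqrtr1.
by exists (SigSub (mem_set uv)).
Qed.

Lemma dotC v w : dot v w = dot w v.
Proof. by apply: eq_bigr => i _; rewrite mulrC. Qed.

Lemma dotBl u v w : dot (u - v) w = dot u w - dot v w.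
Proof. by rewrite /dot -sumrB; apply: eq_bigr => i _; rewrite !mxE mulrBl. Qed.

Lemma dotBr u v w : dot w (u - v) = dot w u - dot w v.
Proof. by rewrite dotC dotBl !(dotC w). Qed.

Lemma chord_sqr x y : chord x y ^+ 2 = 2 - 2 * dot (\val x) (\val y).
Proof.
rewrite eucl_norm_sqr dotBl !dotBr !dot_val (dotC (\val y)); ring.
Qed.

Lemma chord_ge0 x y : 0 <= chord x y. Proof. exact: eucl_norm_ge0. Qed.

Lemma chordC x y : chord x y = chord y x.
Proof.
apply/eqP; rewrite -(eqrXn2 (n := 2))// ?chord_ge0//.
by rewrite !chord_sqr dotC.
Qed.

Lemma chord_eq0 x y : chord x y = 0 -> x = y.
Proof.
move=> xy0; apply: val_inj; apply/rowP => i; apply/eqP; rewrite -subr_eq0.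
have : chord x y ^+ 2 = 0 by rewrite xy0 expr0n.
rewrite eucl_norm_sqr => /eqP; rewrite psumr_eq0; last by move=> j _; rewrite -expr2 sqr_ge0.
by move=> /allP /(_ i (mem_index_enum i)); rewrite -expr2 sqrf_eq0 !mxE.
Qed.

Lemma dot_itv x y : -1 <= dot (\val x) (\val y) <= 1.
Proof.
have nx v : dot v v = 1 -> eucl_norm v = 1 by rewrite eucl_normE => ->; rewrite sqrtr1.
have h := dot_le (\val x) (\val y); rewrite !nx ?dot_val// mulr1 in h.
have := sqr_ge0 (eucl_norm (\val x + \val y)); rewrite eucl_norm_sqr.
have -> : dot (\val x + \val y) (\val x + \val y) = 2 + 2 * dot (\val x) (\val y).
  have := dot_val x; have := dot_val y; rewrite !dotE !mxE; lra.
by move=> ?; apply/andP; split; lra.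
Qed.

(** This is the closed form of the spherical distance, see [spherical_distE]. *)
Definition angle x y : R := acos (dot (\val x) (\val y)).

Lemma cos_angle x y : cos (angle x y) = dot (\val x) (\val y).
Proof. by rewrite /angle acosK// in_itv /= dot_itv. Qed.

Lemma angle_ge0 x y : 0 <= angle x y. Proof. exact: acos_ge0 (dot_itv x y). Qed.

Lemma angle_lepi x y : angle x y <= pi. Proof. exact: acos_lepi (dot_itv x y). Qed.

Lemma angleC x y : angle x y = angle y x. Proof. by rewrite /angle dotC. Qed.

Lemma anglexx x : angle x x = 0. Proof. by rewrite /angle dot_val acos1. Qed.

(** When the sum is below [pi], the addition formula for the cosine reduces the claim to [(a * b -
    c) ^ 2 <= (1 - a ^ 2) * (1 - b ^ 2)]. This says that the Gram determinant of three unit vectors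
    is nonnegative, and it is the square of their determinant [D]. *)
Lemma angle_triangle x y z : angle x z <= angle x y + angle y z.
Proof.
have [h|h] := leP pi (angle x y + angle y z); first exact: le_trans (angle_lepi _ _) h.
rewrite leNgt; apply/negP => lt.
have xy0 := angle_ge0 x y; have yz0 := angle_ge0 y z.
have : cos (angle x z) < cos (angle x y + angle y z).
  rewrite ltr_cos// in_itv /= ?angle_ge0 ?angle_lepi ?addr_ge0//=; lra.
rewrite cosD !cos_angle.
have sq (p q : S2 R) : sin (angle p q) = Num.sqrt (1 - dot (\val p) (\val q) ^+ 2).
  by rewrite /angle sin_acos// dot_itv.
rewrite !sq -sqrtrM; last first.
  by have := dot_itv x y; move=> /andP[? ?]; rewrite subr_ge0; nra.
set a := dot (\val x) (\val y); set b := dot (\val y) (\val z); set c := dot (\val x) (\val z).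
move=> cab.
have gram : (a * b - c) ^+ 2 <= (1 - a ^+ 2) * (1 - b ^+ 2).
  have := dot_val x; have := dot_val y; have := dot_val z.
  rewrite /a /b /c !dotE.
  move: (\val x 0 0) (\val x 0 1) (\val x 0 2) => x0 x1 x2.
  move: (\val y 0 0) (\val y 0 1) (\val y 0 2) => y0 y1 y2.
  move: (\val z 0 0) (\val z 0 1) (\val z 0 2) => z0 z1 z2.
  move=> zz yy xx.
  pose D := x0 * (y1 * z2 - y2 * z1) - x1 * (y0 * z2 - y2 * z0) + x2 * (y0 * z1 - y1 * z0).
  set a' := x0 * y0 + x1 * y1 + x2 * y2; set b' := y0 * z0 + y1 * z1 + y2 * z2.
  set c' := x0 * z0 + x1 * z1 + x2 * z2.
  have : D ^+ 2 = 1 + 2 * a' * b' * c' - a' ^+ 2 - b' ^+ 2 - c' ^+ 2.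
    transitivity ((x0 * x0 + x1 * x1 + x2 * x2) * (y0 * y0 + y1 * y1 + y2 * y2) *
      (z0 * z0 + z1 * z1 + z2 * z2) + 2 * a' * b' * c'
      - (z0 * z0 + z1 * z1 + z2 * z2) * a' ^+ 2
      - (x0 * x0 + x1 * x1 + x2 * x2) * b' ^+ 2
      - (y0 * y0 + y1 * y1 + y2 * y2) * c' ^+ 2).
      by rewrite /D /a' /b' /c'; ring.
    by rewrite xx yy zz !mul1r.
  by have := sqr_ge0 D; move=> D0 De; rewrite De in D0; nra.
have : a * b - c <= Num.sqrt ((1 - a ^+ 2) * (1 - b ^+ 2)).
  by apply: le_trans (ler_norm _) _; rewrite -sqrtr_sqr ler_wsqrtr.
by move: cab; lra.
Qed.

Lemma mul_cos_le_sin (t : R) : 0 <= t <= pi / 2 -> t * cos t <= sin t <= t.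
Proof.
move=> /andP[t0 tp].
have d1 (u : R) : is_derive u 1 (fun u : R => sin u - u * cos u) (u * sin u).
  by apply: is_derive_eq; rewrite /GRing.scale/= ; ring.
have d2 (u : R) : is_derive u 1 (fun u : R => u - sin u) (1 - cos u).
  by apply: is_derive_eq.
have cont (f f' : R -> R) (fd : forall u : R, is_derive u 1 f (f' u)) :
    {within `[0, t], continuous f}.
  apply: derivable_within_continuous => u _.
  exact: (@ex_derive _ _ _ _ _ _ _ (fd u)).
have h1 := @ger0_derive1_ndecr R (fun u => sin u - u * cos u) 0 t _ _ (cont _ _ d1)
   0 t (lexx _) t0 (lexx _).
have h2 := @ger0_derive1_ndecr R (fun u => u - sin u) 0 t _ _ (cont _ _ d2)
   0 t (lexx _) t0 (lexx _).
apply/andP; split; last first.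
  move: h2; rewrite sin0 subr0 subr_ge0; apply.
    by move=> u _; exact: (@ex_derive _ _ _ _ _ _ _ (d2 u)).
  by move=> u _; rewrite derive1E (@derive_val _ _ _ _ _ _ _ (d2 u)) subr_ge0 cos_le1.
move: h1; rewrite sin0 mul0r subr0 subr_ge0; apply.
  by move=> u _; exact: (@ex_derive _ _ _ _ _ _ _ (d1 u)).
move=> u; rewrite in_itv /= => /andP[u0 ut].
rewrite derive1E (@derive_val _ _ _ _ _ _ _ (d1 u)) mulr_ge0// ?(ltW u0)//.
have := pi_ge0 R => p0.
by apply: sin_ge0_pi; rewrite (ltW u0)/=; lra.
Qed.

Lemma chord_angle x y : chord x y = 2 * sin (angle x y / 2).
Proof.
have p0 := pi_ge0 R; have a0 := angle_ge0 x y; have a1 := angle_lepi x y.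
have s0 : 0 <= sin (angle x y / 2).
  by apply: sin_ge0_pi; apply/andP; split; lra.
apply/eqP; rewrite -(eqrXn2 (n := 2))// ?chord_ge0 ?mulr_ge0//.
apply/eqP; rewrite chord_sqr -cos_angle.
rewrite {1}(_ : angle x y = (angle x y / 2) *+ 2); last by rewrite mulr2n; lra.
rewrite cos_mulr2n cos2sin2; ring.
Qed.

Lemma chord_le_angle x y : chord x y <= angle x y.
Proof.
have p0 := pi_ge0 R; have a0 := angle_ge0 x y; have a1 := angle_lepi x y.
have /andP[_] : angle x y / 2 * cos (angle x y / 2) <= sin (angle x y / 2) <= angle x y / 2.
  by apply: mul_cos_le_sin; apply/andP; split; lra.
by rewrite chord_angle; lra.
Qed.

(** With [t] the half angle, [1 - chord ^ 2 / 4 = cos t ^ 2 <= cos t], and [t * cos t <= sin t]. *)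
Lemma angle_le_chord x y : angle x y * (1 - chord x y ^+ 2 / 4) <= chord x y.
Proof.
have p0 := pi_ge0 R; have a0 := angle_ge0 x y; have a1 := angle_lepi x y.
have /andP[+ _] : angle x y / 2 * cos (angle x y / 2) <= sin (angle x y / 2) <= angle x y / 2.
  by apply: mul_cos_le_sin; apply/andP; split; lra.
rewrite chord_angle; set t := angle x y / 2 => h.
have c0 : 0 <= cos t by apply: cos_ge0_pihalf; rewrite /t; apply/andP; split; lra.
have c1 : cos t <= 1 by apply: cos_le1.
have -> : 1 - (2 * sin t) ^+ 2 / 4 = cos t ^+ 2 by rewrite cos2sin2; field.
have -> : angle x y = 2 * t by rewrite /t; field.
have : cos t ^+ 2 <= cos t by nra.
have t0 : 0 <= t by rewrite /t; lra.
nra.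
Qed.

Lemma angle_lipschitz (e : R) : 0 < e -> exists2 d : R, 0 < d &
  forall x y, chord x y < d -> angle x y <= (1 + e) * chord x y.
Proof.
(* This radius gives [(1 + e) * (chord ^ 2 / 4) <= e], as [angle_le_chord] requires. *)
move=> e0; exists (Num.min 1 (e / (1 + e))).
  by rewrite lt_min ltr01 divr_gt0//; lra.
move=> x y; rewrite lt_min => /andP[c1 ce]; have c0 := chord_ge0 x y.
have h := angle_le_chord x y; have a0 := angle_ge0 x y.
rewrite ltr_pdivlMr in ce; last lra.
have : 1 <= (1 + e) * (1 - chord x y ^+ 2 / 4) by nra.
nra.
Qed.

End Euclid.

(** * Lengths of curves *)

Section Curves.
Variable R : realType.

Lemma is_derive_nondecreasing (f f' : R -> R) (a b : R) : a <= b ->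
  (forall t, a <= t <= b -> is_derive t 1 f (f' t)) ->
  (forall t, a <= t <= b -> 0 <= f' t) -> f a <= f b.
Proof.
move=> ab fd f0.
have dv t : a <= t <= b -> derivable f t 1.
  by move=> /fd ft; exact: (@ex_derive _ _ _ _ _ _ _ ft).
apply: (@ger0_derive1_ndecr R f a b) => //.
- move=> t; rewrite in_itv /= => /andP[a_t tb]; apply: dv; by rewrite !ltW.
- move=> t; rewrite in_itv /= => /andP[a_t tb].
  have tab : a <= t <= b by rewrite !ltW.
  by rewrite derive1E (@derive_val _ _ _ _ _ _ _ (fd t tab)) f0.
- by apply: derivable_within_continuous => t; rewrite in_itv /=; apply: dv.
Qed.

Lemma continuous_antiderivative (f : R -> R) (a b : R) : continuous f ->
  exists F : R -> R, forall t, a < t < b -> is_derive t 1 F (f t).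
Proof.
move=> fc; exists (fun x => \int[lebesgue_measure]_(t in `[a, x]) f t).
move=> t /andP[a_t tb].
have [] := @continuous_FTC1_closed R f a t b tb _ a_t (fc t).
  apply: continuous_compact_integrable; first exact: segment_compact.
  exact: continuous_subspaceT.
by move=> dF FE; split=> //; rewrite -derive1E FE.
Qed.

Lemma integral_antiderivative (f F : R -> R) (a b : R) : a < b -> continuous f ->
  (forall t, a <= t <= b -> is_derive t 1 F (f t)) ->
  (\int[lebesgue_measure]_(t in `[a, b]) (f t)%:E = (F b - F a)%:E)%E.
Proof.
move=> ab fc dF.
have dv t : a <= t <= b -> derivable F t 1.
  by move=> /dF ft; exact: (@ex_derive _ _ _ _ _ _ _ ft).
have Fcont t : a <= t <= b -> {for t, continuous F}.
  by move=> /dv/derivable1_diffP/differentiable_continuous.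
rewrite (continuous_FTC2 ab (F := F)) ?EFinB//.
- exact: continuous_subspaceT.
- split.
  + by move=> t; rewrite in_itv /= => /andP[? ?]; apply: dv; rewrite !ltW.
  + by apply: cvg_at_right_filter; apply: Fcont; rewrite lexx ltW.
  + by apply: cvg_at_left_filter; apply: Fcont; rewrite lexx ltW.
- move=> t; rewrite in_itv /= => /andP[a_t tb].
  have tab : a <= t <= b by rewrite !ltW.
  by rewrite derive1E (@derive_val _ _ _ _ _ _ _ (dF t tab)).
Qed.

Definition speed (g : R -> 'rV[R]_3) (t : R) : R := eucl_norm ((g^`())%classic t).

Lemma C1_coord (g : R -> 'rV[R]_3) (i : 'I_3) (t : R) : C1_curve g ->
  is_derive t 1 (fun u => g u 0 i) ((g^`())%classic t 0 i).
Proof.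
move=> [dg _]; have := dg t => /[dup] dgt /derivable_mxP /(_ 0 i) di.
by split=> //; rewrite derive1E derive_mx// mxE.
Qed.

Lemma C1_speed_continuous (g : R -> 'rV[R]_3) : C1_curve g -> continuous (speed g).
Proof.
move=> [_ cg] t.
apply: (@continuous_comp _ _ _ (fun u => \sum_(i < 3) (g^`()%classic u) 0 i ^+ 2)
  (fun u : R => Num.sqrt u)); last exact: sqrt_continuous.
have ci i : {for t, continuous (fun u => (g^`()%classic u) 0 i ^+ 2)}.
  apply: (@continuous_comp _ _ _ (fun u => g^`()%classic u) (fun M : 'rV[R]_3 => M 0 i ^+ 2)).
    exact: cg.
  apply: (@continuous_comp _ _ _ (fun M : 'rV[R]_3 => M 0 i) (fun u : R => u ^+ 2)).
    exact: coord_continuous.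
  exact: exprn_continuous.
rewrite (_ : (fun u => \sum_(i < 3) _) = fun u => (g^`()%classic u) 0 0 ^+ 2 +
  (g^`()%classic u) 0 1 ^+ 2 + (g^`()%classic u) 0 2 ^+ 2); last first.
  by apply/funext => u; rewrite sum_ord3.
by do 2?apply: continuousD; exact: ci.
Qed.

(** Project on the direction of the displacement [w]: by Cauchy-Schwarz the derivative of
    [N * F t - dot (g t) w] is nonnegative, and comparing its ends gives
    [N ^ 2 <= N * (F b - F a)]. *)
Lemma C1_displacement (g : R -> 'rV[R]_3) (F : R -> R) (a b : R) : C1_curve g -> a <= b ->
  (forall t, a <= t <= b -> is_derive t 1 F (speed g t)) ->
  eucl_norm (g b - g a) <= F b - F a.
Proof.
move=> Cg ab dF; set w := g b - g a; set N := eucl_norm w.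
have N0 : 0 <= N := eucl_norm_ge0 w.
have : N * F a - dot (g a) w <= N * F b - dot (g b) w.
  apply: (@is_derive_nondecreasing (fun t => N * F t - dot (g t) w)
    (fun t => N * speed g t - dot (g^`()%classic t) w)) => // t tab.
    have d0 := C1_coord 0 t Cg; have d1 := C1_coord 1 t Cg; have d2 := C1_coord 2 t Cg.
    have dFt := dF t tab.
    rewrite (_ : (fun _ => _) = (fun t => N * F t -
      (g t 0 0 * w 0 0 + g t 0 1 * w 0 1 + g t 0 2 * w 0 2))); last first.
      by apply/funext => u; rewrite dotE.
    by apply: is_derive_eq; rewrite dotE /GRing.scale /=; ring.
  by rewrite subr_ge0 mulrC dot_le.
have Nw : N ^+ 2 = dot (g b) w - dot (g a) w by rewrite eucl_norm_sqr {1}/w dotBl.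
have [->|Npos] := eqVneq N 0.
  rewrite subr_ge0 => _; apply: is_derive_nondecreasing ab dF _ => t _.
  exact: eucl_norm_ge0.
move=> h; have {}Npos : 0 < N by rewrite lt_def Npos.
rewrite -(ler_pM2l Npos) -expr2 Nw mulrBr; lra.
Qed.

Section LocalLipschitz.
(** Two instances serve below: [angle], to bound [spherical_dist] from below, and the difference of
    two values of [d x0], to bound [d] from above. *)
Variable rho : S2 R -> S2 R -> R.
Hypotheses (rho_xx : forall x, rho x x = 0)
  (rho_triangle : forall x y z, rho x z <= rho x y + rho y z)
  (rho_lip : forall e, 0 < e -> exists2 d, 0 < d &
     forall x y, chord x y < d -> rho x y <= (1 + e) * chord x y).

(** Cut [[a, b]] into [n] steps so short that, with speed at most [K], every chord is below the
    scale [d] of [rho_lip]; the triangle inequality then sums the local bounds, up to a factor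
    [1 + e']. *)
Lemma C1_rho_le (g : R -> 'rV[R]_3) (c : R -> S2 R) (F : R -> R) (a b : R) :
  C1_curve g -> a < b -> (forall t, a <= t <= b -> \val (c t) = g t) ->
  (forall t, a <= t <= b -> is_derive t 1 F (speed g t)) ->
  rho (c a) (c b) <= F b - F a.
Proof.
move=> Cg ab cg dF.
have disp t t' : a <= t -> t <= t' -> t' <= b -> chord (c t) (c t') <= F t' - F t.
  move=> a_t tt' tb; rewrite chordC /chord !cg; [|by apply/andP; split; lra..].
  apply: C1_displacement => // u /andP[tu ut']; apply: dF; apply/andP; split; lra.
have cs : {within `[a, b], continuous speed g}.
  by apply: continuous_subspaceT; apply: C1_speed_continuous.
have [m _ mP] := EVT_max (ltW ab) cs; set K := speed g m in mP.
have K0 : 0 <= K := eucl_norm_ge0 _.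
have FK t t' : a <= t -> t <= t' -> t' <= b -> F t' - F t <= K * (t' - t).
  move=> a_t tt' tb.
  suff : K * t - F t <= K * t' - F t' by lra.
  apply: (@is_derive_nondecreasing (fun t => K * t - F t) (fun t => K - speed g t)) => //.
    move=> u /andP[tu ut']; have dFu : is_derive u 1 F (speed g u).
      by apply: dF; apply/andP; split; lra.
    by apply: is_derive_eq; rewrite /GRing.scale /= mulr1.
  move=> u /andP[tu ut']; rewrite subr_ge0; apply: mP.
  by rewrite in_itv /=; apply/andP; split; lra.
have F0 : 0 <= F b - F a.
  exact: le_trans (chord_ge0 _ _) (disp a b (lexx _) (ltW ab) (lexx _)).
apply/ler_addgt0Pr => e e0.
pose e' := e / (F b - F a + 1).
have e'0 : 0 < e' by rewrite divr_gt0//; lra.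
have [d d0 dP] := rho_lip e'0.
pose n := (Num.truncn (K * (b - a) / d)).+1.
have n0 : 0 < n%:R :> R by rewrite ltr0n.
have nd : K * (b - a) / d < n%:R.
  have /truncn_itv/andP[] // : 0 <= K * (b - a) / d.
  by rewrite divr_ge0 ?(ltW d0)// mulr_ge0//; lra.
pose q := (b - a) / n%:R.
have q0 : 0 <= q by rewrite divr_ge0 ?(ltW n0)//; lra.
have nq : n%:R * q = b - a by rewrite /q mulrC divfK// gt_eqF.
have Kq : K * q < d by rewrite /q mulrA ltr_pdivrMr// [ltRHS]mulrC -ltr_pdivrMr.
have key i : (i <= n)%N -> rho (c a) (c (a + i%:R * q)) <= (1 + e') * (F (a + i%:R * q) - F a).
  elim: i => [|i IH] iN; first by rewrite mulr0n mul0r addr0 rho_xx subrr mulr0 lexx.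
  apply: le_trans (rho_triangle _ (c (a + i%:R * q)) _) _.
  have iq0 : 0 <= i%:R * q by rewrite mulr_ge0.
  have iq1 : i.+1%:R * q <= b - a by rewrite -nq ler_wpM2r// ler_nat.
  rewrite -natr1 mulrDl mul1r in iq1 *.
  set t := a + i%:R * q in IH *; set t' := a + _.
  have h1 := disp t t'; have h2 := FK t t'.
  have h : a <= t /\ t <= t' /\ t' <= b by rewrite /t /t'; lra.
  case: h => ha [hb hc].
  have {}h1 := h1 ha hb hc; have {}h2 := h2 ha hb hc.
  have tq : t' - t = q by rewrite /t /t'; ring.
  have := dP (c t) (c t') _; rewrite tq in h2 => /(_ (le_lt_trans h1 (le_lt_trans h2 Kq))).
  have := IH (ltnW iN).
  have : (1 + e') * chord (c t) (c t') <= (1 + e') * (F t' - F t).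
    by rewrite ler_pM2l//; lra.
  lra.
have := key n (leqnn n); rewrite nq.
have -> : a + (b - a) = b by ring.
move=> /le_trans; apply.
have : e' * (F b - F a) <= e by rewrite /e' mulrAC ler_pdivrMr; nra.
by lra.
Qed.

(** Induction on the subdivision, carrying measurability so that the integral can be split. [insubd]
    returns points of the curve to the sphere type, with [y0] as default value off the sphere. *)
Lemma piecewise_rho_le (c : R -> 'rV[R]_3) (y0 : S2 R) (a : R) (s : seq R) :
  path <%R a s ->
  (forall t, a <= t <= last a s -> unit_sphere (c t)) ->
  (forall i, (i < size s)%N -> exists g : R -> 'rV[R]_3,
      C1_curve g /\
      forall t, nth 0 (a :: s) i <= t <= nth 0 s i -> c t = g t) ->
  exists L : R, [/\ measurable_fun `[a, last a s] (speed c),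
    (\int[lebesgue_measure]_(t in `[a, last a s]) (speed c t)%:E = L%:E)%E &
    rho (insubd y0 (c a)) (insubd y0 (c (last a s))) <= L].
Proof.
elim: s a => [|b s IH] a /= ; first move=> _ _ _.
  exists 0; rewrite set_itv1 rho_xx; split=> //.
    exact: measurable_fun_set1.
  by rewrite integral_set1.
move=> /andP[ab bs] us pc.
have le_last (u : R) (r : seq R) : path <%R u r -> u <= last u r.
  elim: r u => //= v r IHr u /andP[uv /IHr]; apply: le_trans; exact: ltW.
have bl := le_last _ _ bs.
have [L [mL iL rL]] : exists L : R, [/\ measurable_fun `[b, last b s] (speed c),
    (\int[lebesgue_measure]_(t in `[b, last b s]) (speed c t)%:E = L%:E)%E &
    rho (insubd y0 (c b)) (insubd y0 (c (last b s))) <= L].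
  apply: IH => //.
    by move=> t /andP[bt tl]; apply: us; rewrite tl (le_trans (ltW ab)).
  by move=> i ils; apply: (pc i.+1).
have [g [Cg cg]] := pc 0%N isT; rewrite /= in cg.
(* The margin of 1 on both sides makes [F] differentiable at [a] and [b] as well. *)
have [F dF] := continuous_antiderivative (a - 1) (b + 1) (C1_speed_continuous Cg).
have {}dF t : a <= t <= b -> is_derive t 1 F (speed g t).
  by move=> tab; apply: dF; lra.
(* The curve may have corners at [a] and [b], so velocities agree on the open interval only; two
   points do not change the integral. *)
have sE : {in `]a, b[, speed c =1 speed g}.
  move=> t; rewrite in_itv /= => /andP[a_t tb]; rewrite /speed; congr eucl_norm.
  rewrite !derive1E; apply: near_eq_derive.
  near=> u; apply: cg; apply/andP; split; apply: ltW; near: u.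
    exact: lt_nbhsr.
  exact: lt_nbhsl.
have mg : measurable_fun `]a, b[ (speed g).
  apply: measurable_funTS; apply: continuous_measurable_fun.
  exact: C1_speed_continuous.
have mc : measurable_fun `]a, b[ (speed c).
  by apply: eq_measurable_fun mg => t; rewrite inE /= => /sE ->.
have mc' : measurable_fun `[a, b] (speed c).
  exact: (measurable_fun_itv_cc (b0 := false) (b1 := true)) mc.
have ib : (\int[lebesgue_measure]_(t in `[a, b]) (speed c t)%:E = (F b - F a)%:E)%E.
  rewrite -(integral_antiderivative ab (C1_speed_continuous Cg) dF).
  exact: eq_integral_itv_bounded.
have eU : `[a, last b s]%classic = `[a, b]%classic `|` `]b, last b s]%classic :> set R.
  by rewrite -itv_bndbnd_setU// bnd_simp ltW.
have mbo : measurable_fun `]b, last b s] (speed c).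
  by apply: measurable_funS mL => //; apply: subset_itvr; rewrite bnd_simp.
exists (F b - F a + L); split.
- by rewrite eU; apply/measurable_funU => //; split.
- rewrite eU ge0_integral_setU//=.
  + rewrite ib integral_itv_obnd_cbnd ?iL//.
    exact/measurable_EFinP.
  + by apply/measurable_EFinP; apply/measurable_funU => //; split.
  + by move=> t _; rewrite lee_fin eucl_norm_ge0.
  + apply/disj_setPS => t /= [] ; rewrite !in_itv /= => /andP[_ tb] /andP[bt _].
    by move: (lt_le_trans bt tb); rewrite ltxx.
- apply: le_trans (rho_triangle _ (insubd y0 (c b)) _) _; apply: lerD rL.
  apply: (C1_rho_le (c := fun t => insubd y0 (c t)) Cg ab _ dF) => t /[dup] tab /andP[a_t tb].
  rewrite val_insubd ifT; first exact: cg.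
  by apply: mem_set; apply: us; rewrite a_t (le_trans tb).
Unshelve. all: by end_near.
Qed.

Lemma curve_length_ge (x y : S2 R) (c : R -> 'rV[R]_3) : sphere_curve x y c ->
  rho x y <= curve_length c.
Proof.
move=> [[s [ps ls pc]] us c0 c1].
have us' t : 0 <= t <= last 0 s -> unit_sphere (c t) by rewrite ls; exact: us.
have [L [_ iL]] := piecewise_rho_le x ps us' pc.
rewrite ls c0 c1 !valKd => /le_trans; apply.
by rewrite /curve_length /Rintegral -/(speed c) -ls [X in fine X]iL.
Qed.

End LocalLipschitz.

End Curves.

(** * Great-circle arcs and the spherical distance *)

Section SphericalDist.
Variable R : realType.
Implicit Types (x y z : S2 R).

Lemma dotDl (u v w : 'rV[R]_3) : dot (u + v) w = dot u w + dot v w.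
Proof. by rewrite !dotE !mxE; ring. Qed.

Lemma dotDr (u v w : 'rV[R]_3) : dot w (u + v) = dot w u + dot w v.
Proof. by rewrite !dotE !mxE; ring. Qed.

Lemma dotZl (a : R) (v w : 'rV[R]_3) : dot (a *: v) w = a * dot v w.
Proof. by rewrite !dotE !mxE; ring. Qed.

Lemma dotZr (a : R) (v w : 'rV[R]_3) : dot w (a *: v) = a * dot w v.
Proof. by rewrite !dotE !mxE; ring. Qed.

Lemma dot_eq0 (v : 'rV[R]_3) : dot v v = 0 -> v = 0.
Proof.
move=> /eqP; rewrite psumr_eq0; last by move=> j _; rewrite -expr2 sqr_ge0.
move=> /allP v0; apply/rowP => i; apply/eqP.
by have := v0 i (mem_index_enum i); rewrite -expr2 sqrf_eq0 !mxE.
Qed.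

Definition vec3 (a b c : R) : 'rV[R]_3 :=
  \row_i (if i == 0 then a else if i == 1 then b else c).

Lemma vec3E a b c : (vec3 a b c 0 0 = a) * (vec3 a b c 0 1 = b) * (vec3 a b c 0 2 = c).
Proof. by rewrite !mxE /=. Qed.

(** Turn the horizontal projection by a right angle and normalize it; at the two poles take the
    first basis vector. *)
Lemma orthogonal_unit x : exists w, dot w w = 1 /\ dot (\val x) w = 0.
Proof.
set v := \val x; have v1 : dot v v = 1 := dot_val x; rewrite dotE in v1.
pose s := v 0 0 ^+ 2 + v 0 1 ^+ 2.
have s0 : 0 <= s by rewrite addr_ge0 ?sqr_ge0.
have [s1|s1] := eqVneq s 0.
  exists (vec3 1 0 0); rewrite !dotE !vec3E; split; first by ring.
  have := sqr_ge0 (v 0 0); have := sqr_ge0 (v 0 1) => h1 h2.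
  have /eqP : v 0 0 ^+ 2 = 0 by rewrite /s in s1; lra.
  by rewrite sqrf_eq0 => /eqP->; ring.
pose r := Num.sqrt s; have r2 : r ^+ 2 = s by rewrite sqr_sqrtr.
have rn : r != 0 by rewrite -sqrf_eq0 r2.
exists (vec3 (- v 0 1 / r) (v 0 0 / r) 0); rewrite !dotE !vec3E; split; last by field.
transitivity (s / r ^+ 2); first by rewrite /s; field.
by rewrite r2 divff.
Qed.

(** [w] is the normalized component of [y] orthogonal to [x]. If the sine vanishes that component is
    zero, and any orthogonal unit vector does. *)
Lemma arc_decomposition x y : exists w, [/\ dot w w = 1, dot (\val x) w = 0 &
  \val y = cos (angle x y) *: \val x + sin (angle x y) *: w].
Proof.
set a := cos (angle x y); set s := sin (angle x y).
have ca : a = dot (\val x) (\val y) by apply: cos_angle.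
have as1 : a ^+ 2 + s ^+ 2 = 1 by rewrite cos2Dsin2.
pose u := \val y - a *: \val x.
have uu : dot u u = s ^+ 2.
  have -> : s ^+ 2 = 1 - a ^+ 2 by rewrite -as1; ring.
  rewrite /u dotBl !dotBr !dotZl !dotZr !dot_val (dotC (\val y)) -ca; ring.
have [s0|s0] := eqVneq s 0.
  have [w [ww xw]] := orthogonal_unit x; exists w; split=> //.
  rewrite s0 scale0r addr0; apply/eqP; rewrite -subr_eq0; apply/eqP.
  by apply: dot_eq0; rewrite -/u uu s0 expr0n.
exists (s^-1 *: u); split.
- by rewrite dotZl dotZr uu expr2 mulKf // mulVf.
- by rewrite dotZr /u dotBr dotZr dot_val mulr1 -ca subrr mulr0.
- by rewrite scalerA divff// scale1r /u addrC subrK.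
Qed.

Definition arc (L : R) (v w : 'rV[R]_3) (t : R) : 'rV[R]_3 :=
  cos (L * t) *: v + sin (L * t) *: w.

Definition arc' (L : R) (v w : 'rV[R]_3) (t : R) : 'rV[R]_3 :=
  (- L * sin (L * t)) *: v + (L * cos (L * t)) *: w.

Lemma arc_derive L v w (t : R) : derivable (arc L v w) t 1 /\
  ((arc L v w)^`())%classic t = arc' L v w t.
Proof.
have di (j : 'I_1) (i : 'I_3) : is_derive t 1 (fun u => arc L v w u j i) (arc' L v w t j i).
  rewrite (_ : (fun u => _) = fun u => cos (L * u) * v j i + sin (L * u) * w j i).
    by apply: is_derive_eq; rewrite !mxE /GRing.scale /=; ring.
  by apply/funext => u; rewrite !mxE.
have dv : derivable (arc L v w) t 1.
  by apply/derivable_mxP => j i; exact: (@ex_derive _ _ _ _ _ _ _ (di j i)).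
split=> //; rewrite derive1E derive_mx//; apply/matrixP => j i; rewrite mxE.
exact: (@derive_val _ _ _ _ _ _ _ (di j i)).
Qed.

Lemma arc_C1 L v w : C1_curve (arc L v w).
Proof.
split=> [t|]; first by case: (arc_derive L v w t).
rewrite (_ : (arc L v w)^`()%classic = arc' L v w); last first.
  by apply/funext => t; case: (arc_derive L v w t).
have cZ (k : R -> R) (u : 'rV[R]_3) (t : R) : derivable k t 1 ->
    {for t, continuous (fun t => k t *: u)}.
  move=> dk; apply: continuousZr_tmp.
  exact/differentiable_continuous/derivable1_diffP.
by move=> t; apply: (@continuousD _ _ _ (fun t => (- L * sin (L * t)) *: v)
  (fun t => (L * cos (L * t)) *: w)); apply: cZ; exact: ex_derive.
Qed.

Lemma arc_curve x y : exists2 c, sphere_curve x y c & curve_length c = angle x y.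
Proof.
have [w [ww xw yE]] := arc_decomposition x y.
set L := angle x y in yE *; exists (arc L (\val x) w).
  split.
  - exists [:: 1]; split; rewrite /= ?ltr01// => -[|i]// _.
    by exists (arc L (\val x) w); split=> //; exact: arc_C1.
  - move=> t _; rewrite /unit_sphere /= eucl_normE /arc.
    rewrite !dotDl !dotDr !dotZl !dotZr !dot_val (dotC w) xw ww.
    rewrite !mulr1 !mulr0 addr0 add0r -!expr2 cos2Dsin2 sqrtr1//.
  - by rewrite /arc mulr0 cos0 sin0 scale1r scale0r addr0.
  - by rewrite /arc mulr1.
have L0 : 0 <= L := angle_ge0 x y.
have sp t : eucl_norm ((arc L (\val x) w)^`()%classic t) = L.
  have [_ ->] := arc_derive L (\val x) w t.
  rewrite eucl_normE /arc' !dotDl !dotDr !dotZl !dotZr !dot_val (dotC w) xw ww.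
  rewrite -[RHS]ger0_norm// -sqrtr_sqr; congr Num.sqrt.
  transitivity (L ^+ 2 * (cos (L * t) ^+ 2 + sin (L * t) ^+ 2)); first by ring.
  by rewrite cos2Dsin2 mulr1.
rewrite /curve_length; under eq_Rintegral do rewrite sp.
rewrite /Rintegral integral_cst//= [X in (_ * X)%E](_ : _ = 1%:E) ?mule1//.
apply: etrans (lebesgue_measure_itv `[0, 1]%R) _.
by rewrite /= lte_fin ltr01 -EFinB subr0.
Qed.

(** No curve is shorter than the angle, by [curve_length_ge] for [rho := angle], and a great-circle
    arc attains it. *)
Lemma spherical_distE x y : spherical_dist x y = angle x y.
Proof.
have lb c : sphere_curve x y c -> angle x y <= curve_length c.
  apply: (@curve_length_ge R (@angle R)); first exact: anglexx.
    exact: angle_triangle.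
  exact: angle_lipschitz.
have [c Cc cL] := arc_curve x y.
apply/eqP; rewrite eq_le; apply/andP; split.
  rewrite -cL; apply: ge_inf; last by exists c.
  by exists (angle x y) => _ [c' /lb ? <-].
apply: lb_le_inf; first by exists (curve_length c), c.
by move=> _ [c' /lb ? <-].
Qed.

End SphericalDist.

(** * Comparison with the plane *)

Section Topology.
Variable R : realType.
Implicit Types (x y z : S2 R) (d : S2 R -> S2 R -> R).

Lemma coord_le_chord x y (i : 'I_3) : `|\val x 0 i - \val y 0 i| <= chord x y.
Proof.
rewrite -sqrtr_sqr; apply: ler_wsqrtr.
rewrite (bigD1 i)//= !mxE lerDl; apply: sumr_ge0 => j _; exact: sqr_ge0.
Qed.

Lemma open_chordP (U : set (S2 R)) : open U <->
  forall x, U x -> exists2 e : R, 0 < e & [set y | chord x y < e] `<=` U.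
Proof.
have bP x e y : ball x e y <-> 0 < e /\ forall i, `|\val x 0 i - \val y 0 i| < e.
  split=> [[e0 xy]|[e0 xy]]; split=> //.
    by move=> i; apply: xy.
  by move=> i j; rewrite (ord1 i); apply: xy.
rewrite openE; split=> [oU x /oU|oU x /oU [e e0 eU]].
  rewrite /interior => /nbhs_ballP [e /= e0 eU]; exists e => // y /= xy; apply: eU.
  by apply/bP; split=> // i; apply: le_lt_trans xy; exact: coord_le_chord.
(* The chord is at most [sqrt 3 < 2] times the sup distance. *)
apply/nbhs_ballP; exists (e / 2) => [|y /bP [e20 xy]]; first by rewrite /= divr_gt0.
apply: eU; rewrite /= -(@ltr_pXn2r _ 2)// ?nnegrE ?chord_ge0 ?(ltW e0)//.
rewrite eucl_norm_sqr dotE !mxE -!expr2.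
have sq i : (\val x 0 i - \val y 0 i) ^+ 2 < (e / 2) ^+ 2.
  by rewrite -(real_normK (num_real _)) ltrXn2r ?nnegrE// ltW.
by have := sq 0; have := sq 1; have := sq 2; rewrite !exprMn; nra.
Qed.

Lemma angle_eq0 x y : angle x y = 0 -> x = y.
Proof.
move=> xy0; apply: chord_eq0; apply/eqP.
by rewrite eq_le chord_ge0 -xy0 chord_le_angle.
Qed.

Lemma angle_metric : is_metric (@angle R).
Proof.
split; [exact: angle_ge0| |exact: angleC|exact: angle_triangle].
by move=> x y; split=> [|->]; [exact: angle_eq0|exact: anglexx].
Qed.

Lemma angle_topology : induces_topology (@angle R).
Proof.
move=> U; rewrite open_chordP; split=> oU x /oU [e e0 eU].
  by exists e => // y /= xy; apply: eU; apply: le_lt_trans xy; exact: chord_le_angle.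
have [r r0 rP] := @angle_lipschitz R 1 ltr01.
exists (Num.min r (e / 2)); first by rewrite lt_min r0 divr_gt0.
move=> y /=; rewrite lt_min => /andP[/rP xyr xye]; apply: eU => /=; lra.
Qed.

Lemma metric_chord_continuous d x (e : R) : is_metric d -> induces_topology d -> 0 < e ->
  exists2 r, 0 < r & forall y, chord x y < r -> d x y < e.
Proof.
move=> dm dt e0.
have [] := (open_chordP [set y | d x y < e]).1 _ x.
- apply/dt => y /= xy; exists (e - d x y); first by rewrite subr_gt0.
  move=> z /= yz; change (d x z < e).
  apply: le_lt_trans (Defs.metric_triangle dm x y z) _; lra.
- by rewrite /= (metric_eq0 dm x x).2.
by move=> r r0 rP; exists r.
Qed.

End Topology.

(** This is what the rigidity argument retains of the equality of total measures. [B] contains a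
    collar of [d]-width [k] around [A]. *)
Definition no_local_excess (R : realType) (T : Type) (d0 d : T -> T -> R) : Prop :=
  forall (A B : set T) (k e : R), 0 < k -> 0 < e ->
  (forall x y, A x -> ~ B y -> k < d x y) ->
  exists2 r0 : R, 0 < r0 & forall r, 0 < r <= r0 ->
    (hausdorff2_pre d r A <= hausdorff2_pre d0 r B + e%:E)%E.

(* The premeasure of [d] is additive on the separated sets [A] and [~` B], and on
   [~` B] it is at least that of [d0], so an excess on [A] would be visible in
   the total. *)
Lemma eq_hausdorff2_no_local_excess (R : realType) (T : Type) (d0 d : T -> T -> R) :
  (forall x y, d0 x y <= d x y) -> (hausdorff2 d0 setT < +oo)%E ->
  hausdorff2 d setT = hausdorff2 d0 setT -> no_local_excess d0 d.
Proof.
move=> d0d H0oo Heq A B k e k0 e0 sep.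
have {Heq} Hle : (hausdorff2 d setT <= hausdorff2 d0 setT)%E.
  rewrite Heq; exact: lexx.
have le_H (d' : T -> T -> R) r : 0 < r -> (hausdorff2_pre d' r setT <= hausdorff2 d' setT)%E.
  by move=> r0; apply: ereal_sup_ubound; exists r.
have H00 : (0 <= hausdorff2 d0 setT)%E.
  by apply: le_trans (hausdorff2_pre_ge0 _ _ _) (le_H _ 1 ltr01).
have H0fin : hausdorff2 d0 setT \is a fin_num by rewrite ge0_fin_numE.
have [_ [r1 r10 <-] r1P] := ub_ereal_sup_adherent e0 H0fin.
exists (Num.min k r1); first by rewrite lt_min k0.
move=> r /andP[r0]; rewrite le_min => /andP[rk rr1].
have Bc : (hausdorff2_pre d0 r (~` B) < +oo)%E.
  apply: le_lt_trans H0oo; apply: le_trans (le_H _ _ r0).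
  exact: le_hausdorff2_pre.
have Bcfin : hausdorff2_pre d0 r (~` B) \is a fin_num.
  by rewrite ge0_fin_numE ?hausdorff2_pre_ge0.
(* The [d0]-premeasure of the complement of [B] is finite, so it may be added to both sides. *)
rewrite -(leeD2rE _ _ Bcfin).
apply: (@le_trans _ _ (hausdorff2_pre d r A + hausdorff2_pre d r (~` B))%E).
  by rewrite leeD2l// hausdorff2_pre_le_metric.
apply: (le_trans (hausdorff2_pre_separated _ (ltW r0))) => [x y Ax By|].
  exact: le_lt_trans rk (sep x y Ax By).
apply: (le_trans (le_hausdorff2_pre _ _ (@subsetT _ _))).
apply: (le_trans (le_H _ _ r0)); apply: (le_trans Hle).
have -> : (hausdorff2_pre d0 r B + e%:E + hausdorff2_pre d0 r (~` B) =
  (hausdorff2_pre d0 r B + hausdorff2_pre d0 r (~` B)) + e%:E)%E by rewrite addeAC.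
rewrite -leeBlDr//; apply: (le_trans (ltW r1P)).
apply: (le_trans (hausdorff2_pre_anti _ _ rr1)).
by rewrite -(setUv B); exact: hausdorff2_preU.
Qed.

Section PatchUpperBound.
Variables (R : realType) (T : Type) (d : T -> T -> R) (X : set T) (u v : T -> R).

(** Pull the planar covers back through the chart [(u, v)]: a planar set of diameter [t <= e] has
    preimage in [X] of [d]-diameter at most [C * t <= r], so [rectangle_le] applies with the
    constant [pi / 4 * C ^ 2]. *)
Lemma patch_upper_bound (M : nat) (C W H e r : R) : 0 < disc_ratio R M ->
  0 < e -> 0 <= C -> 0 <= W -> 0 <= H -> C * e <= r ->
  (forall p, X p -> `|u p| <= W /\ `|v p| <= H) ->
  (forall p q t, X p -> X q -> 0 <= t <= e ->
     (u p - u q) ^+ 2 + (v p - v q) ^+ 2 <= t ^+ 2 -> d p q <= C * t) ->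
  (hausdorff2_pre d r X <=
    (pi / 4 * C ^+ 2 / disc_ratio R M * (4 * W * H))%:E)%E.
Proof.
move=> B0 e0 C0 W0 H0 Ce Xb Xd.
pose phi (Q : set (R * R)) := hausdorff2_pre d r (X `&` [set p | Q (u p, v p)]).
have XR : X `<=` X `&` [set p | rectangle W H (u p, v p)].
  by move=> p Xp; split=> //; exact: Xb.
apply: (le_trans (le_hausdorff2_pre _ _ XR)).
apply: (@rectangle_le R phi _ e) => //.
- by rewrite mulr_ge0 ?divr_ge0 ?pi_ge0// sqr_ge0.
- by move=> A B AB; apply: le_hausdorff2_pre => p [Xp Ap]; split=> //; exact: AB.
- move=> A B; apply: le_trans (hausdorff2_preU _ _ _ _).
  by apply: le_hausdorff2_pre => p [Xp []]; [left|right].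
move=> A t /andP[t0 te] At.
rewrite -mulrA -exprMn; apply: hausdorff2_pre_diam.
  by rewrite mulr_ge0//= (le_trans _ Ce)// ler_wpM2l.
move=> p q [Xp Ap] [Xq Aq]; apply: Xd => //; first by rewrite t0.
exact: At Ap Aq.
Qed.

End PatchUpperBound.

(** Subtracting the sphere equations expresses [(w - w') * (w + w')] as a planar inner product.
    Cauchy-Schwarz bounds it, while [w + w' >= 2 * c]. *)
Lemma graph_lipschitz (R : realType) (c m u v w u' v' w' : R) : 0 < c ->
  c <= w -> c <= w' ->
  u ^+ 2 + v ^+ 2 + w ^+ 2 = 1 -> u' ^+ 2 + v' ^+ 2 + w' ^+ 2 = 1 ->
  u ^+ 2 + v ^+ 2 <= m -> u' ^+ 2 + v' ^+ 2 <= m ->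
  c ^+ 2 * (w - w') ^+ 2 <= m * ((u - u') ^+ 2 + (v - v') ^+ 2).
Proof.
move=> c0 cw cw' h h' um um'.
set D := (u - u') ^+ 2 + (v - v') ^+ 2.
have D0 : 0 <= D by rewrite addr_ge0 ?sqr_ge0.
have e1 : (w - w') * (w + w') = - ((u - u') * (u + u') + (v - v') * (v + v')).
  nra.
have s1 : (u + u') ^+ 2 + (v + v') ^+ 2 <= 4 * m.
  by have := sqr_ge0 (u - u'); have := sqr_ge0 (v - v'); nra.
have cs : ((w - w') * (w + w')) ^+ 2 <= D * (4 * m).
  rewrite e1 sqrrN; apply: (@le_trans _ _ (D * ((u + u') ^+ 2 + (v + v') ^+ 2))).
    rewrite -subr_ge0 /D.
    have -> : ((u - u') ^+ 2 + (v - v') ^+ 2) * ((u + u') ^+ 2 + (v + v') ^+ 2) -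
      ((u - u') * (u + u') + (v - v') * (v + v')) ^+ 2 =
      ((u - u') * (v + v') - (v - v') * (u + u')) ^+ 2 by ring.
    exact: sqr_ge0.
  exact: ler_wpM2l.
have cc : 4 * c ^+ 2 <= (w + w') ^+ 2 by nra.
have := sqr_ge0 (w - w'); rewrite exprMn in cs; nra.
Qed.

(** Six caps on which some signed coordinate is at least [1 / 2] cover the sphere, and each is a
    Lipschitz graph over a planar square. The bound [K] for a cap is independent of the scale
    [r]. *)
Lemma hausdorff2_angle_fin (R : realType) : (hausdorff2 (@angle R) setT < +oo)%E.
Proof.
have [M [n [M0 _ Mn]]] := @disc_ratio_gt R 0 (introT andP (conj (lexx 0) ltr01)).
have B0 : 0 < disc_ratio R M.
  apply: le_lt_trans Mn; rewrite mulr_ge0 ?invr_ge0//.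
  by apply: sumr_ge0 => k _; exact: sqrtr_ge0.
(* The Lipschitz factor 4 combines [chord <= 2 * t], from [graph_lipschitz] with [c = 1 / 2] and
   [m = 3 / 4], with [angle <= 2 * chord] at small scales. *)
pose K : R := pi / 4 * 4 ^+ 2 / disc_ratio R M * (4 * 1 * 1).
have [r1 r10 r1P] := @angle_lipschitz R 1 ltr01.
have patch (r : R) (X : set (S2 R)) (u v w : S2 R -> R) : 0 < r ->
    (forall p, u p ^+ 2 + v p ^+ 2 + w p ^+ 2 = 1) ->
    (forall p q, chord p q ^+ 2 = (u p - u q) ^+ 2 + (v p - v q) ^+ 2 + (w p - w q) ^+ 2) ->
    (forall p, X p -> 1 / 2 <= w p) ->
    (hausdorff2_pre (@angle R) r X <= K%:E)%E.
  move=> r0 uvw1 uvwc Xw; pose e := Num.min (r / 4) (r1 / 4).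
  have e0 : 0 < e by rewrite lt_min !divr_gt0.
  have er : 4 * e <= r.
    have : e <= r / 4 by rewrite ge_min lexx.
    by lra.
  have er1 : 4 * e <= r1.
    have : e <= r1 / 4 by rewrite ge_min lexx orbT.
    by lra.
  apply: (@patch_upper_bound R _ _ X u v M 4 1 1 e) => //.
    move=> p Xp; have := uvw1 p; have := Xw p Xp => h1 h2.
    rewrite !ler_norml; split; apply/andP; split; nra.
  move=> p q t Xp Xq /andP[t0 te] pq.
  have := @graph_lipschitz R (1 / 2) (3 / 4) (u p) (v p) (w p) (u q) (v q) (w q).
  have := Xw p Xp; have := Xw q Xq; have := uvw1 p; have := uvw1 q.
  move=> hq hp wq wp /(_ _ wp wq hp hq) hg.
  have {}hg : (w p - w q) ^+ 2 <= 3 * ((u p - u q) ^+ 2 + (v p - v q) ^+ 2).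
    have : 0 < 1 / 2 :> R by lra.
    by move=> /hg; rewrite expr_div_n expr1n => h; have := h; nra.
  have c2 : chord p q <= 2 * t.
    rewrite -(@ler_pXn2r _ 2)// ?nnegrE ?chord_ge0 ?mulr_ge0//.
    by rewrite uvwc exprMn; lra.
  have c0 := chord_ge0 p q.
  have [t00|t0'] := eqVneq t 0.
    have -> : p = q by apply: chord_eq0; lra.
    by rewrite anglexx mulr_ge0.
  have {}t0 : 0 < t by rewrite lt_def t0'.
  have := r1P p q; have -> : chord p q < r1 by lra.
  by move=> /(_ isT); lra.
have Hb (r : R) : 0 < r -> (hausdorff2_pre (@angle R) r setT <= (K + K + (K + K) + (K + K))%:E)%E.
  move=> r0; pose X (b : bool) (i : 'I_3) : set (S2 R) :=
    [set p : S2 R | 1 / 2 <= (if b then 1 else -1 : R) * \val p 0 i].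
  have cover : [set: S2 R] `<=` (X true 0 `|` X false 0) `|` (X true 1 `|` X false 1)
      `|` (X true 2 `|` X false 2).
    move=> p _; have := dot_val p; rewrite dotE.
    set a := \val p 0 0; set b := \val p 0 1; set c := \val p 0 2 => abc.
    have [|a1] := leP (1 / 2) a; first by move=> h; left; left; left; rewrite /X /= -/a; lra.
    have [|a2] := leP (1 / 2) (- a); first by move=> h; left; left; right; rewrite /X /= -/a; lra.
    have [|b1] := leP (1 / 2) b; first by move=> h; left; right; left; rewrite /X /= -/b; lra.
    have [|b2] := leP (1 / 2) (- b); first by move=> h; left; right; right; rewrite /X /= -/b; lra.
    have [|c1] := leP (1 / 2) c; first by move=> h; right; left; rewrite /X /= -/c; lra.
    have [|c2] := leP (1 / 2) (- c); first by move=> h; right; right; rewrite /X /= -/c; lra.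
    by exfalso; nra.
  have un (A B : set (S2 R)) (a b : R) : (hausdorff2_pre (@angle R) r A <= a%:E)%E ->
      (hausdorff2_pre (@angle R) r B <= b%:E)%E ->
      (hausdorff2_pre (@angle R) r (A `|` B) <= (a + b)%:E)%E.
    by move=> ha hb; apply: le_trans (hausdorff2_preU _ _ _ _) _; rewrite EFinD leeD.
  (* The hypothesis on [F] encodes that [j], [k], [i] is a permutation of the three indices. *)
  have one (b : bool) (i j k : 'I_3) : (forall F : 'I_3 -> R, F 0 + F 1 + F 2 = F j + F k + F i) ->
      (hausdorff2_pre (@angle R) r (X b i) <= K%:E)%E.
    move=> per; apply: (@patch r (X b i) (fun p => \val p 0 j) (fun p => \val p 0 k)
      (fun p => (if b then 1 else -1 : R) * \val p 0 i)) => //.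
      move=> p; have := dot_val p; rewrite /dot sum_ord3.
      rewrite (per (fun l => \val p 0 l * \val p 0 l)) => h; rewrite -[RHS]h.
      by case: b => /=; ring.
    move=> p q; rewrite eucl_norm_sqr /dot sum_ord3.
    rewrite (per (fun l => (\val p - \val q) 0 l * (\val p - \val q) 0 l)) !mxE.
    by case: b => /=; ring.
  apply: (le_trans (le_hausdorff2_pre _ _ cover)).
  apply: (un); first apply: (un); apply: un.
  - by apply: (one true 0 1 2) => F; ring.
  - by apply: (one false 0 1 2) => F; ring.
  - by apply: (one true 1 0 2) => F; ring.
  - by apply: (one false 1 0 2) => F; ring.
  - by apply: (one true 2 0 1) => F; ring.
  - by apply: (one false 2 0 1) => F; ring.
apply: (@le_lt_trans _ _ (K + K + (K + K) + (K + K))%:E); last exact: ltry.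
by apply/ereal_supP => _ [r r0 <-]; exact: Hb.
Qed.

Section Frames.
Variable R : realType.
Implicit Types (x y z p q : S2 R).

(** These are the coordinates in an orthonormal basis, restricted to the sphere; see
    [orthonormal_frame]. *)
Record frame (u v w : S2 R -> R) : Prop := Frame {
  frame_sqr : forall p, u p ^+ 2 + v p ^+ 2 + w p ^+ 2 = 1;
  frame_chord : forall p q,
    chord p q ^+ 2 = (u p - u q) ^+ 2 + (v p - v q) ^+ 2 + (w p - w q) ^+ 2;
  frame_point : forall a b c : R, a ^+ 2 + b ^+ 2 + c ^+ 2 = 1 ->
    exists p, [/\ u p = a, v p = b & w p = c] }.

(** The square matrix [O] with the given rows satisfies [O *m O^T = 1], hence also
    [O^T *m O = 1]. *)
Lemma parseval (e0 e1 e2 v : 'rV[R]_3) :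
  dot e0 e0 = 1 -> dot e1 e1 = 1 -> dot e2 e2 = 1 ->
  dot e0 e1 = 0 -> dot e0 e2 = 0 -> dot e1 e2 = 0 ->
  dot v v = dot v e0 ^+ 2 + dot v e1 ^+ 2 + dot v e2 ^+ 2.
Proof.
move=> e00 e11 e22 e01 e02 e12.
pose e (i : 'I_3) := if i == 0 then e0 else if i == 1 then e1 else e2.
pose O : 'M[R]_3 := \matrix_(i, j) e i 0 j.
have OE (a : 'rV[R]_3) i : (a *m O^T) 0 i = dot a (e i).
  by rewrite mxE; apply: eq_bigr => k _; rewrite !mxE.
have OO : O *m O^T = 1%:M.
  apply/matrixP => i j; rewrite !mxE.
  transitivity (dot (e i) (e j)); first by apply: eq_bigr => k _; rewrite !mxE.
  case: i => -[|[|[|//]]] hi; case: j => -[|[|[|//]]] hj; rewrite /e /= //;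
    by rewrite dotC.
have vv (a : 'rV[R]_3) : dot a a = (a *m a^T) 0 0.
  by rewrite mxE; apply: eq_bigr => k _; rewrite !mxE.
have : dot v v = dot (v *m O^T) (v *m O^T).
  rewrite !vv trmx_mul trmxK mulmxA -[v *m O^T *m O]mulmxA.
  by rewrite (mulmx1C OO) mulmx1.
by move=> ->; rewrite dotE !OE /e /= !expr2.
Qed.

Lemma orthonormal_frame (e0 e1 e2 : 'rV[R]_3) :
  dot e0 e0 = 1 -> dot e1 e1 = 1 -> dot e2 e2 = 1 ->
  dot e0 e1 = 0 -> dot e0 e2 = 0 -> dot e1 e2 = 0 ->
  frame (fun p => dot (\val p) e0) (fun p => dot (\val p) e1) (fun p => dot (\val p) e2).
Proof.
move=> e00 e11 e22 e01 e02 e12; split.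
- by move=> p; rewrite -(parseval _ e00 e11 e22 e01 e02 e12) dot_val.
- move=> p q; rewrite eucl_norm_sqr (parseval _ e00 e11 e22 e01 e02 e12).
  by rewrite !dotBl.
move=> a b c abc.
have ve (x : 'rV[R]_3) : dot (a *: e0 + b *: e1 + c *: e2) x =
    a * dot e0 x + b * dot e1 x + c * dot e2 x by rewrite !dotDl !dotZl.
have v0 : dot (a *: e0 + b *: e1 + c *: e2) e0 = a.
  by rewrite ve e00 (dotC e1) (dotC e2) e01 e02; ring.
have v1 : dot (a *: e0 + b *: e1 + c *: e2) e1 = b.
  by rewrite ve e11 (dotC e2) e01 e12; ring.
have v2 : dot (a *: e0 + b *: e1 + c *: e2) e2 = c.
  by rewrite ve e22 e02 e12; ring.
have [p pE] : exists p, \val p = a *: e0 + b *: e1 + c *: e2.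
  by apply: S2_of; rewrite (parseval _ e00 e11 e22 e01 e02 e12) v0 v1 v2.
by exists p; rewrite pE v0 v1 v2.
Qed.

Definition cross (a b : 'rV[R]_3) : 'rV[R]_3 :=
  vec3 (a 0 1 * b 0 2 - a 0 2 * b 0 1) (a 0 2 * b 0 0 - a 0 0 * b 0 2)
       (a 0 0 * b 0 1 - a 0 1 * b 0 0).

Lemma dot_crossl (a b : 'rV[R]_3) : dot a (cross a b) = 0.
Proof. by rewrite dotE !vec3E; ring. Qed.

Lemma dot_crossr (a b : 'rV[R]_3) : dot b (cross a b) = 0.
Proof. by rewrite dotE !vec3E; ring. Qed.

Lemma dot_cross (a b : 'rV[R]_3) :
  dot (cross a b) (cross a b) = dot a a * dot b b - dot a b ^+ 2.
Proof. by rewrite !dotE !vec3E; ring. Qed.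

(** The axes point along the chord from [y] to [z], along their cross direction, and towards the
    midpoint. The length of [y + z] is [m], positive because [y] and [z] are not antipodal. *)
Lemma symmetric_frame y z : 0 < chord y z -> chord y z < 2 ->
  exists u v w, [/\ frame u v w,
    u y = - (chord y z / 2) /\ u z = chord y z / 2,
    v y = 0 /\ v z = 0 & 0 < w y /\ 0 < w z].
Proof.
set c := chord y z => c0 c2.
have c4 : 0 < 4 - c ^+ 2 by nra.
have yz : dot (\val y) (\val z) = 1 - c ^+ 2 / 2 by rewrite chord_sqr; field.
pose m := Num.sqrt (4 - c ^+ 2).
have m0 : 0 < m by rewrite sqrtr_gt0.
have m2 : m ^+ 2 = 4 - c ^+ 2 by rewrite sqr_sqrtr// ltW.
have cn : c != 0 by rewrite gt_eqF.
have mn : m != 0 by rewrite gt_eqF.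
pose e0 := c^-1 *: (\val z - \val y); pose e2 := m^-1 *: (\val y + \val z).
have e00 : dot e0 e0 = 1.
  rewrite dotZl dotZr dotBl !dotBr !dot_val (dotC (\val z)) yz; field.
  exact: cn.
have e22 : dot e2 e2 = 1.
  rewrite dotZl dotZr dotDl !dotDr !dot_val (dotC (\val z)) yz.
  transitivity ((4 - c ^+ 2) / m ^+ 2); first by field; exact: mn.
  by rewrite m2 divff// gt_eqF.
have e02 : dot e0 e2 = 0.
  rewrite dotZl dotZr dotBl !dotDr !dot_val (dotC (\val z)); ring.
pose e1 := cross e0 e2.
have e11 : dot e1 e1 = 1 by rewrite dot_cross e00 e22 e02; ring.
have e01 : dot e0 e1 = 0 := dot_crossl _ _.
have e12 : dot e1 e2 = 0 by rewrite dotC; exact: dot_crossr.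
have yE : \val y = (m / 2) *: e2 + (- (c / 2)) *: e0.
  rewrite !scalerA; have -> : m / 2 / m = 1 / 2 by field; exact: mn.
  have -> : - (c / 2) / c = - (1 / 2) by field; exact: cn.
  by apply/rowP => i; rewrite !mxE; field.
have zE : \val z = (m / 2) *: e2 + (c / 2) *: e0.
  rewrite !scalerA; have -> : m / 2 / m = 1 / 2 by field; exact: mn.
  have -> : c / 2 / c = 1 / 2 by field; exact: cn.
  by apply/rowP => i; rewrite !mxE; field.
clearbody e1 e0 e2.
exists (fun p => dot (\val p) e0), (fun p => dot (\val p) e1), (fun p => dot (\val p) e2).
split; first exact: orthonormal_frame.
- by rewrite yE zE !dotDl !dotZl (dotC e2) e02 e00 !mulr0 !mulr1 !add0r.
- by rewrite yE zE !dotDl !dotZl (dotC e2) e12 e01 !mulr0 !addr0.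
- rewrite yE zE !dotDl !dotZl e22 e02 !mulr0 !mulr1 !addr0; split; exact: divr_gt0.
Qed.

(** Here [w >= sqrt (1 / 2)] at both points, so [graph_lipschitz] with [m = e / 2] gives
    [(w p - w q) ^ 2 <= e * D]. *)
Lemma frame_patch (u v w : S2 R -> R) (e : R) p q : frame u v w -> 0 <= e <= 1 ->
  0 < w p -> 0 < w q -> u p ^+ 2 + v p ^+ 2 <= e / 2 -> u q ^+ 2 + v q ^+ 2 <= e / 2 ->
  chord p q ^+ 2 <= ((1 + e) ^+ 2) * ((u p - u q) ^+ 2 + (v p - v q) ^+ 2).
Proof.
move=> fr /andP[e0 e1] wp wq up uq.
have sp := frame_sqr fr p; have sq := frame_sqr fr q.
pose c : R := Num.sqrt (1 / 2).
have c2 : c ^+ 2 = 1 / 2 by rewrite sqr_sqrtr// divr_ge0.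
have c0 : 0 < c by rewrite sqrtr_gt0 divr_gt0.
have cw t : 0 < t -> 1 / 2 <= t ^+ 2 -> c <= t.
  by move=> t0 tc; rewrite -(@ler_pXn2r _ 2)// ?nnegrE ?(ltW t0) ?(ltW c0)// c2.
have wp' : c <= w p by apply: cw => //; lra.
have wq' : c <= w q by apply: cw => //; lra.
have := graph_lipschitz c0 wp' wq' sp sq up uq.
rewrite c2 (frame_chord fr).
set D := (u p - u q) ^+ 2 + (v p - v q) ^+ 2 => h.
have D0 : 0 <= D by rewrite addr_ge0 ?sqr_ge0.
nra.
Qed.

End Frames.

Lemma weight_sum_gt0 (R : realType) (s h : R) (n : nat) : 0 < h -> 1 <= n%:R * h ->
  0 < weight_sum s h n.
Proof.
move=> h0; case: n => [|n _]; first by rewrite mulr0n mul0r ler10.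
rewrite /weight_sum mulr_gt0// big_ord_recl mulr0 expr0n /= subr0 sqrtr1.
by rewrite ltr_pwDl// sumr_ge0// => k _; exact: sqrtr_ge0.
Qed.

(** * Lower bound for the premeasure of a rectangular patch *)

Section LowerBound.
Variables (R : realType) (d : S2 R -> S2 R -> R) (x0 : S2 R).
Variables (u v w : S2 R -> R) (G : R -> R -> S2 R) (l b a s e h : R) (n : nat).
Let f (p : S2 R) := d x0 p.
Let D : set (S2 R) := [set p | [/\ `|u p| <= l, `|v p| <= b & 0 < w p]].
Hypotheses (dm : is_metric d) (dt : induces_topology d)
  (ad : forall x y, angle x y <= d x y) (fr : frame u v w)
  (GP : forall x y : R, x ^+ 2 + y ^+ 2 <= 1 / 2 ->
     [/\ u (G x y) = x, v (G x y) = y & 0 < w (G x y)])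
  (l0 : 0 < l) (b0 : 0 < b) (bl : b <= l) (lle : 16 * l ^+ 2 <= e) (e1 : e <= 1)
  (a0 : 0 <= a) (s0 : 0 <= s) (h0 : 0 < h) (nh : 1 <= n%:R * h)
  (f_incr : forall y, `|y| <= b -> a * (2 * l) <= f (G l y) - f (G (- l) y))
  (f_lip : forall p q, D p -> D q -> s * (f p - f q) <= chord p q).

Let f_le p q : f p - f q <= d p q.
Proof.
have := Defs.metric_triangle dm x0 q p.
by rewrite (Defs.metric_sym dm q p) /f; lra.
Qed.

Let e0 : 0 <= e. Proof. by apply: le_trans lle; rewrite mulr_ge0// sqr_ge0. Qed.

Let sqr_bound (x y : R) : `|x| <= 2 * l -> `|y| <= 2 * l -> x ^+ 2 + y ^+ 2 <= e / 2.
Proof.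
have l20 : 0 <= 2 * l by rewrite mulr_ge0// ltW.
have sq (t : R) : `|t| <= 2 * l -> t ^+ 2 <= 4 * l ^+ 2.
  move=> tl; rewrite -(real_normK (num_real t)).
  have := normr_ge0 t; nra.
by move=> /sq xl /sq yl; have := lle; lra.
Qed.

Let G_chord (x y x' y' : R) : `|x| <= 2 * l -> `|y| <= 2 * l -> `|x'| <= 2 * l -> `|y'| <= 2 * l ->
  chord (G x y) (G x' y') ^+ 2 <= (1 + e) ^+ 2 * ((x - x') ^+ 2 + (y - y') ^+ 2).
Proof.
move=> xl yl xl' yl'.
have B1 := sqr_bound xl yl; have B2 := sqr_bound xl' yl'.
have [|u1 v1 w1] := GP (x := x) (y := y); first by have := e1; lra.
have [|u2 v2 w2] := GP (x := x') (y := y'); first by have := e1; lra.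
have := @frame_patch _ _ _ _ e (G x y) (G x' y') fr.
rewrite u1 v1 u2 v2; apply => //; exact/andP.
Qed.

Let le_2l (x c : R) : c <= l -> `|x| <= c -> `|x| <= 2 * l.
Proof. by move=> cl xc; have := l0; lra. Qed.

Let G_row_continuous (y : R) : `|y| <= b ->
  {within `[- l, l], continuous (fun x => f (G x y))}.
Proof.
move=> yb; apply: continuous_in_subspaceT => x; rewrite inE /= in_itv /= -ler_norml => xl.
apply/cvgrPdist_lt => k k0.
have [r r0 rP] := metric_chord_continuous (G x y) dm dt k0.
have m0 : 0 < Num.min l (r / 2) by rewrite lt_min l0 divr_gt0.
near=> t.
have tx : `|x - t| < Num.min l (r / 2).
  by near: t; apply: (@cvgr_dist_lt _ _ _ (nbhs x)) => //; exact: cvg_id.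
move: tx; rewrite lt_min => /andP[tl tr].
(* [t] may leave [[- l, l]], but it stays within [2 * l], where [G_chord] still holds. *)
have tl2 : `|t| <= 2 * l.
  have -> : t = x - (x - t) by ring.
  by apply: le_trans (ler_normB _ _) _; lra.
have c : chord (G x y) (G t y) < r.
  rewrite -(@ltr_pXn2r _ 2)// ?nnegrE ?chord_ge0 ?(ltW r0)//.
  apply: (le_lt_trans (G_chord (le_2l (lexx l) xl) (le_2l bl yb) tl2 (le_2l bl yb))).
  rewrite subrr expr0n addr0 -(real_normK (num_real (x - t))).
  have := e0; have := e1; have := normr_ge0 (x - t).
  move: tr; set q := `|x - t| => tr q0 e1' e0'.
  have : (1 + e) ^+ 2 <= 4 by nra.
  have : q ^+ 2 < (r / 2) ^+ 2 by nra.
  have := sqr_ge0 q; nra.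
apply: le_lt_trans (rP _ c).
by rewrite ler_norml; have := f_le (G x y) (G t y); have := f_le (G t y) (G x y);
  rewrite (Defs.metric_sym dm (G t y)); lra.
Unshelve. all: by end_near.
Qed.

(** Pull a cover back through [G] and apply [row_inequality] to [f] in the chart. Planar distance is
    at most the chord, hence at most [d]; conversely the chord is at most [1 + e] times planar
    distance, whence the slope [s / (1 + e)]. *)
Lemma patch_lower_bound (r : R) : 0 < r ->
  ((pi / 4 * (a * (2 * l) * (2 * b)) / weight_sum (s / (1 + e)) h n)%:E <=
   hausdorff2_pre d r D)%E.
Proof.
move=> r0; set ws := weight_sum _ _ _.
have ws0 : 0 < ws by apply: weight_sum_gt0.
apply/ereal_infP => _ [C [DC Cr] <-].
pose t i := fine (diam d (C i)).
have tE i : diam d (C i) = (t i)%:E.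
  rewrite fineK// ge0_fin_numE ?diam_ge0//.
  by apply: le_lt_trans (Cr i) _; rewrite ltry.
have t0 i : 0 <= t i by rewrite -lee_fin -tE diam_ge0.
have Ct i p q : C i p -> C i q -> d p q <= t i.
  move=> Cp Cq; have := (@diam_leP R _ d (C i) (t i) (t0 i)).2.
  by rewrite tE => /(_ (lexx _)); apply.
pose A i : set (R * R) := [set p | [/\ `|p.1| <= l, `|p.2| <= b & C i (G p.1 p.2)]].
have GD (x y : R) : `|x| <= l -> `|y| <= b ->
    [/\ u (G x y) = x, v (G x y) = y & D (G x y)].
  move=> xl yb; have B1 := sqr_bound (le_2l (lexx l) xl) (le_2l bl yb).
  have [|u1 v1 w1] := GP (x := x) (y := y); first by have := e1; lra.
  by split=> //; rewrite /D /= u1 v1.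
have l0' := ltW l0; have b0' := ltW b0.
have s1 : 0 <= s / (1 + e) by rewrite divr_ge0// addr_ge0.
have := @row_inequality R (fun x y => f (G x y)) A t l b a (s / (1 + e)) h n
  l0' b0' a0 s1 h0 nh t0 G_row_continuous f_incr.
move=> /(_ _ _ _ _) row.
have {row} : ((a * (2 * l) * (2 * b))%:E <= \sum_(i <oo) (t i ^+ 2 * ws)%:E)%E.
  apply: row.
  - move=> x y xl yb; have [_ _ Dxy] := GD x y xl yb.
    by have [i _ Ci] := DC _ Dxy; exists i; split.
  - move=> i [x y] [x' y'] [/= xl yb Cp] [/= xl' yb' Cq].
    have [u1 v1 _] := GD x y xl yb; have [u2 v2 _] := GD x' y' xl' yb'.
    apply: (@le_trans _ _ (chord (G x y) (G x' y') ^+ 2)).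
      by rewrite (frame_chord fr) u1 v1 u2 v2 lerDl sqr_ge0.
    rewrite ler_pXn2r ?nnegrE ?chord_ge0//.
    exact: le_trans (chord_le_angle _ _) (le_trans (ad _ _) (Ct _ _ _ Cp Cq)).
  - move=> i [x y] [x' y'] [/= xl yb Cp] [/= xl' yb' Cq].
    exact: le_trans (f_le _ _) (Ct _ _ _ Cp Cq).
  - move=> i x x' y [/= xl yb Cp] [/= xl' _ Cq].
    have [_ _ D1] := GD x y xl yb; have [_ _ D2] := GD x' y xl' yb.
    have e10 : 0 < 1 + e by have := e0; lra.
    rewrite mulrAC ler_pdivrMr//; apply: le_trans (f_lip D1 D2) _.
    rewrite -(@ler_pXn2r _ 2)// ?nnegrE ?chord_ge0 ?mulr_ge0 ?(ltW e10)//.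
    apply: le_trans (G_chord (le_2l (lexx l) xl) (le_2l bl yb)
      (le_2l (lexx l) xl') (le_2l bl yb)) _.
    by rewrite subrr expr0n addr0 exprMn (real_normK (num_real _)) mulrC.
move=> row.
have k0 : (0 <= (pi / 4 / ws)%:E)%E by rewrite lee_fin !divr_ge0 ?pi_ge0 ?(ltW ws0).
have := lee_wpmul2l k0 row.
rewrite -nneseriesZl; last by move=> i _; rewrite lee_fin mulr_ge0 ?sqr_ge0 ?(ltW ws0).
rewrite -EFinM mulrAC => /le_trans; apply.
rewrite le_eqVlt; apply/orP; left; apply/eqP; apply: eq_eseriesr => i _.
rewrite tE -EFin_expe -!EFinM; congr EFin; field.
by rewrite gt_eqF.
Qed.

End LowerBound.

(** * Rigidity *)

Section Estimates.
Variable R : realType.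
Implicit Types (x c l e k q r t u v w : R).

Lemma sqr_le_of_norm x c : `|x| <= c -> x ^+ 2 <= c ^+ 2.
Proof.
by move=> xc; rewrite -(real_normK (num_real x)) lerXn2r// nnegrE ?(le_trans _ xc).
Qed.

Lemma sqr_1De_le4 e : 0 < e <= 1 -> (1 + e) ^+ 2 <= 4.
Proof. by move=> /andP[? ?]; nra. Qed.

Lemma small_sqr l e : 0 < l -> 2 * l < e / 2 -> e <= 1 -> 16 * l ^+ 2 <= e.
Proof. by move=> ? ? ?; nra. Qed.

Lemma scaled_sqr_lt k q r : 0 < r -> 0 <= q -> q <= r / 4 -> k <= 4 ->
  k * q ^+ 2 < r ^+ 2.
Proof.
move=> r0 q0 qr k4.
have : q ^+ 2 <= (r / 4) ^+ 2 by apply: sqr_le_of_norm; rewrite ger0_norm.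
by rewrite expr_div_n; have := sqr_ge0 q; have := exprn_gt0 2 r0; nra.
Qed.

Lemma sum_sqr_le (x t l e : R) : `|x| <= 2 * l -> `|t| <= 2 * l -> 16 * l ^+ 2 <= e ->
  x ^+ 2 + t ^+ 2 <= e / 2.
Proof. by move=> /sqr_le_of_norm + /sqr_le_of_norm; rewrite !exprMn => *; lra. Qed.

Lemma height_ge_half u v w e : e <= 1 -> 0 < w ->
  u ^+ 2 + v ^+ 2 + w ^+ 2 = 1 -> u ^+ 2 + v ^+ 2 <= e / 2 -> 1 / 2 <= w.
Proof. by move=> *; nra. Qed.

Lemma sqr_dist_le (u v u' v' l b : R) : `|u| <= l -> `|v| <= b -> `|u'| <= l -> `|v'| <= b ->
  b <= l -> (u - u') ^+ 2 + (v - v') ^+ 2 <= (3 * l) ^+ 2.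
Proof.
move=> ul vb ul' vb' bl.
have l0 : 0 <= l := le_trans (normr_ge0 _) ul.
have h1 : (u - u') ^+ 2 <= (2 * l) ^+ 2.
  by apply: sqr_le_of_norm; apply: le_trans (ler_normB _ _) _; lra.
have h2 : (v - v') ^+ 2 <= (2 * l) ^+ 2.
  by apply: sqr_le_of_norm; apply: le_trans (ler_normB _ _) _; lra.
by have := sqr_ge0 l; rewrite !exprMn in h1 h2 *; lra.
Qed.

Lemma collar_area (l b e : R) : 0 < l -> 0 < b -> 0 < e -> b <= l ->
  (l + e * b) * (b + e * b) <= (l * b) * (1 + e) ^+ 2.
Proof.
move=> l0 b0 e0 bl.
have -> : (l * b) * (1 + e) ^+ 2 = (l * (1 + e)) * (b * (1 + e)) by ring.
have -> : b + e * b = b * (1 + e) by ring.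
apply: ler_wpM2r; first by rewrite mulr_ge0//; lra.
by rewrite mulrDr mulr1 lerD2l mulrC ler_wpM2r// ltW.
Qed.

(** By convexity the power lies below its secant between 0 and 1. *)
Lemma exprn_1D_le (x : R) m : 0 <= x <= 1 -> (1 + x) ^+ m <= 1 + (2 ^+ m - 1) * x.
Proof.
move=> /andP[x0 x1]; elim: m => [|m IH]; first by rewrite !expr0 subrr mul0r addr0.
have m1 : 1 <= 2 ^+ m :> R by apply: exprn_ege1; rewrite ler1n.
rewrite !exprS; move: (2 ^+ m) m1 IH => y y1 IH.
have x10 : 0 <= 1 + x by lra.
have := ler_wpM2l x10 IH => /le_trans; apply; rewrite -subr_ge0.
have -> : 1 + (2 * y - 1) * x - (1 + x) * (1 + (y - 1) * x) = (y - 1) * (x * (1 - x)) by ring.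
by rewrite !mulr_ge0// subr_ge0.
Qed.

(* The supremum [s] of [P] is positive by [P_pos]; if it were at most [t], then
   [P_step] between points just below and just above it would give [B <= A]. *)
Lemma threshold_bootstrap (P : R -> Prop) (A B t : R) :
  0 <= A -> A < B -> B <= 1 -> 0 <= t ->
  (forall s s', 0 <= s -> s <= s' -> P s' -> P s) ->
  (forall s', 0 < s' -> ~ P s' -> B <= (1 + 1) ^+ 7 * s') ->
  (forall s s' e, 0 < s -> s <= t -> P s -> 0 < s' -> ~ P s' -> 0 < e <= 1 ->
     B <= (1 + e) ^+ 7 * (s' * ((1 + e) / s * A))) ->
  P t.
Proof.
move=> A0 AB B1 t0 P_anti P_pos P_step; apply: contrapT => tN.
have B0 : 0 < B by lra.
(* Since [2 ^ 7 * (B / 256) = B / 2 < B], this value satisfies [P] by [P_pos]. *)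
have c0 : 0 < B / 256 by lra.
have Pc : P (B / 256).
  apply: contrapT => /(P_pos _ c0).
  have -> : (1 + 1) ^+ 7 * (B / 256) = B / 2 by field.
  by lra.
pose S := [set s | 0 <= s /\ P s].
have St s : S s -> s <= t.
  move=> [s0 Ps]; rewrite leNgt; apply/negP => ts; apply: tN.
  exact: P_anti t0 (ltW ts) Ps.
have Sc : S (B / 256) by split; [exact: ltW|exact: Pc].
have supS : has_sup S by split; [exists (B / 256)|exists t => s /St].
have sup0 : 0 < sup S.
  by apply: lt_le_trans c0 _; apply: ub_le_sup => //; case: supS.
have le_supS s : S s -> s <= sup S by apply: ub_le_sup; case: supS.
(* Nine factors [1 + x] arise below, and [(1 + x) ^ 9 * A <= A + 511 * x < B], using [A <= 1]. *)
pose x := (B - A) / 1024.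
have xE : 1024 * x = B - A by rewrite /x; field.
have x0 : 0 < x by lra.
have x1 : x <= 1 by lra.
clearbody x.
have th1 : 1 < 1 + x by lra.
have thp : 0 < 1 + x by lra.
(* Pick [s] in [S] so close to the supremum that [(1 + x) * s] exceeds it. *)
have sth : 0 < sup S - sup S / (1 + x) by rewrite subr_gt0 ltr_pdivrMr// ltr_pMr.
have [s Ss ssup] := sup_adherent sth supS.
have {}ssup : sup S / (1 + x) < s by move: ssup; lra.
have s0 : 0 < s by apply: lt_trans ssup; rewrite divr_gt0.
have s'0 : 0 < (1 + x) * s by rewrite mulr_gt0.
have s'N : ~ P ((1 + x) * s).
  move=> Ps'; have : (1 + x) * s <= sup S by apply: le_supS; split=> //; exact: ltW.
  by rewrite leNgt mulrC -ltr_pdivrMr// ssup.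
have x01 : 0 < x <= 1 by rewrite x0.
have := P_step s _ x s0 (St s Ss) Ss.2 s'0 s'N x01.
have -> : (1 + x) ^+ 7 * ((1 + x) * s * ((1 + x) / s * A)) = (1 + x) ^+ 9 * A.
  by field; rewrite gt_eqF.
have x01' : 0 <= x <= 1 by rewrite ltW.
have := ler_wpM2r A0 (exprn_1D_le 9 x01').
have -> : (2 : R) ^+ 9 = 512 by rewrite -natrX.
have A1 : A <= 1 by lra.
have : x * A <= x by rewrite ler_piMr// ltW.
by move=> h1 h2 h3; lra.
Qed.

End Estimates.

Section Rigidity.
Variables (R : realType) (d : S2 R -> S2 R -> R) (x0 : S2 R).
Hypotheses (dm : is_metric d) (dt : induces_topology d)
  (ad : forall x y, angle x y <= d x y)
  (dloc : no_local_excess (@angle R) d).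
Let f (p : S2 R) := d x0 p.

(** For [s > 0] this says that [f] is locally [s^-1]-Lipschitz, at a uniform scale. Without division
    it also covers [s = 0], where it is trivial and starts the bootstrap. *)
Definition local_slope (s : R) : Prop := exists2 r, 0 < r &
  forall p q, chord p q < r -> s * (f p - f q) <= chord p q.

Let f_le p q : f p - f q <= d p q.
Proof.
have := Defs.metric_triangle dm x0 q p.
by rewrite (Defs.metric_sym dm q p) /f; lra.
Qed.

(** A short pair violating slope [s'] spans a thin rectangle [D] on whose rows [f] climbs at rate
    [s'^-1]. The lower bound for [d] on [D], the upper bound for [angle] on a collar [D'] and
    [no_local_excess] are then compared. *)
Lemma slope_estimate (s s' e h : R) (n M : nat) : 0 <= s -> local_slope s ->
  0 < s' -> ~ local_slope s' -> 0 < e <= 1 -> 0 < h -> 1 <= n%:R * h ->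
  0 < disc_ratio R M ->
  disc_ratio R M <= (1 + e) ^+ 7 * (s' * weight_sum (s / (1 + e)) h n).
Proof.
move=> s0 [rs rs0 rsP] s'0 s'N /andP[e0 e1] h0 nh B0.
have [r1 r10 r1P] := @angle_lipschitz R e e0.
(* [e / 2] keeps the patch nearly flat, [rs / 3] keeps its diameter below the scale of
   [local_slope s], and 1 excludes antipodal points. *)
set r0 := Num.min (e / 2) (Num.min (rs / 3) 1).
have r00 : 0 < r0 by rewrite !lt_min !divr_gt0//= ltr01.
have [z [y [zyr zy]]] : exists z y, chord z y < r0 /\ chord z y < s' * (f z - f y).
  apply: contrapT => nex; apply: s'N; exists r0 => // p q pq.
  by rewrite leNgt; apply/negP => lt; apply: nex; exists p, q.
rewrite chordC in zyr zy.
set c := chord y z in zyr zy.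
move: zyr; rewrite !lt_min => /andP[ce /andP[crs c1]].
have fzy : 0 < f z - f y by rewrite -(pmulr_rgt0 _ s'0) (le_lt_trans _ zy)// chord_ge0.
have c0 : 0 < c.
  rewrite lt_def chord_ge0 andbT; apply/eqP => /chord_eq0 yz.
  by move: fzy; rewrite yz subrr ltxx.
have c2 : c < 2 by lra.
have [u [v [w [fr [uy uz] [vy vz] [wy wz]]]]] := symmetric_frame c0 c2.
rewrite -/c in uy uz; set l := c / 2 in uy uz.
have l0 : 0 < l by rewrite divr_gt0.
have cl : c = 2 * l by rewrite /l; field.
clearbody l.
have e2 : (1 + e) ^+ 2 <= 4 by apply: sqr_1De_le4; rewrite e0.
have lle : 16 * l ^+ 2 <= e by apply: small_sqr; rewrite // -cl.
set a := s'^-1.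
have a0 : 0 < a by rewrite invr_gt0.
have al : a * (2 * l) < f z - f y by rewrite -cl /a mulrC ltr_pdivrMr// mulrC.
(* Half of the surplus over slope [a]: moving each end of the row by less than [b] costs at most [g]
   there, so every row keeps the increment [a * (2 * l)]. *)
set g := (f z - f y - a * (2 * l)) / 2.
have g0 : 0 < g by rewrite divr_gt0// subr_gt0.
have [rz rz0 rzP] := metric_chord_continuous z dm dt g0.
have [ry ry0 ryP] := metric_chord_continuous y dm dt g0.
set b := Num.min l (Num.min (rz / 4) (ry / 4)).
have b0 : 0 < b by rewrite !lt_min l0 !divr_gt0.
have bl : b <= l by rewrite ge_min lexx.
have bz : b <= rz / 4 by rewrite !ge_min lexx orbT.
have by' : b <= ry / 4 by rewrite !ge_min lexx !orbT.
(* [G] inverts the chart on the upper hemisphere; outside the disc it takes the default value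
   [y]. *)
have /choice [G GP] (xy : R * R) : exists p : S2 R, xy.1 ^+ 2 + xy.2 ^+ 2 <= 1 / 2 ->
    [/\ u p = xy.1, v p = xy.2 & 0 < w p].
  have [h12|h12] := leP (xy.1 ^+ 2 + xy.2 ^+ 2) (1 / 2); last by exists y.
  have [|p [pu pv pw]] := frame_point fr (a := xy.1) (b := xy.2)
      (c := Num.sqrt (1 - xy.1 ^+ 2 - xy.2 ^+ 2)).
    by rewrite sqr_sqrtr; [ring|lra].
  by exists p => _; split=> //; rewrite pw sqrtr_gt0; lra.
pose G' x t := G (x, t).
have GP' (x t : R) : x ^+ 2 + t ^+ 2 <= 1 / 2 ->
    [/\ u (G' x t) = x, v (G' x t) = t & 0 < w (G' x t)] by move=> /(GP (x, t)).
have e01 : 0 <= e <= 1 by rewrite ltW.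
have sqe (x t : R) : `|x| <= 2 * l -> `|t| <= 2 * l -> x ^+ 2 + t ^+ 2 <= e / 2.
  by move=> xl tl; apply: sum_sqr_le lle.
have near_end p (x t rp : R) : u p = x -> v p = 0 -> 0 < w p -> `|x| <= l -> `|t| <= b ->
    b <= rp / 4 -> 0 < rp -> chord p (G' x t) < rp.
  move=> px pv pw xl tb brp rp0.
  have xl2 : `|x| <= 2 * l by lra.
  have tl2 : `|t| <= 2 * l by lra.
  have xt := sqe x t xl2 tl2.
  have [|gu gv gw] := GP' x t; first by lra.
  have n0 : `|0 : R| <= 2 * l by rewrite normr0; lra.
  have := frame_patch fr e01 pw gw.
  rewrite px pv gu gv => /(_ (sqe _ _ xl2 n0) xt).
  rewrite subrr expr0n add0r sub0r sqrrN -(real_normK (num_real t)) => ch.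
  rewrite -(@ltr_pXn2r _ 2)// ?nnegrE ?chord_ge0 ?(ltW rp0)//.
  apply: le_lt_trans ch _; apply: scaled_sqr_lt e2 => //.
  exact: le_trans tb brp.
have ll : `|l| <= l by rewrite (ger0_norm (ltW l0)).
have lN : `|- l| <= l by rewrite normrN.
have f_incr t : `|t| <= b -> a * (2 * l) <= f (G' l t) - f (G' (- l) t).
  move=> tb.
  have hz := rzP _ (near_end z l t rz uz vz wz ll tb bz rz0).
  have hy := ryP _ (near_end y (- l) t ry uy vy wy lN tb by' ry0).
  have := f_le z (G' l t); have := f_le (G' (- l) t) y.
  rewrite (Defs.metric_sym dm _ y) => h1 h2.
  have gE : f z - f y - a * (2 * l) = 2 * g by rewrite /g; field.
  lra.
pose D : set (S2 R) := [set p | [/\ `|u p| <= l, `|v p| <= b & 0 < w p]].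
(* The collar width is proportional to the short side, so the collar enlarges the area by a factor
   of at most [(1 + e) ^ 2]. *)
pose k := e * b.
have k0 : 0 < k by rewrite mulr_gt0.
have kb : k <= b by rewrite /k ler_piMl// ltW.
pose D' : set (S2 R) := [set p | [/\ `|u p| <= l + k, `|v p| <= b + k & 0 < w p]].
have D'sq p : D' p -> [/\ u p ^+ 2 + v p ^+ 2 <= e / 2, 1 / 2 <= w p & 0 < w p].
  move=> [up vp wp]; have uv : u p ^+ 2 + v p ^+ 2 <= e / 2 by apply: sqe; lra.
  by split=> //; exact: height_ge_half e1 wp (frame_sqr fr p) uv.
have D'dist p q (t : R) : D' p -> D' q -> 0 <= t ->
    (u p - u q) ^+ 2 + (v p - v q) ^+ 2 <= t ^+ 2 -> chord p q <= (1 + e) * t.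
  move=> /D'sq[pe _ wp] /D'sq[qe _ wq] t0 pqt.
  have e10 : 0 < 1 + e by lra.
  rewrite -(@ler_pXn2r _ 2)// ?nnegrE ?chord_ge0 ?mulr_ge0 ?(ltW e10)//.
  apply: le_trans (frame_patch fr e01 wp wq pe qe) _.
  by rewrite exprMn ler_wpM2l// sqr_ge0.
have DD' : D `<=` D'.
  by move=> p [up vp wp]; split=> //; lra.
have f_lip p q : D p -> D q -> s * (f p - f q) <= chord p q.
  move=> Dp Dq; apply: rsP.
  have := D'dist p q (3 * l) (DD' _ Dp) (DD' _ Dq) _ _.
  move: Dp Dq => [up vp _] [uq vq _].
  move=> H; apply: le_lt_trans (H _ _) _; [lra| |].
    exact: sqr_dist_le up vp uq vq bl.
  apply: (@le_lt_trans _ _ (2 * (3 * l))); last by lra.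
  by rewrite ler_wpM2r//; lra.
set ws := weight_sum (s / (1 + e)) h n.
have ws0 : 0 < ws by apply: weight_sum_gt0.
have sep p q : D p -> ~ D' q -> k / 2 < d p q.
  move=> Dp D'q; apply: (lt_le_trans _ (le_trans (chord_le_angle p q) (ad p q))).
  rewrite ltNge; apply/negP => pq; apply: D'q.
  have [_ wp _] := D'sq p (DD' _ Dp); move: Dp => [up vp _].
  have := frame_chord fr p q; have c00 := chord_ge0 p q => ch.
  have := sqr_ge0 (u p - u q); have := sqr_ge0 (v p - v q); have := sqr_ge0 (w p - w q).
  move=> h1 h2 h3.
  have co (i j : R) : (i - j) ^+ 2 <= chord p q ^+ 2 -> `|i - j| <= k / 2.
    move=> ij; apply: le_trans pq.
    by rewrite -(@ler_pXn2r _ 2)// ?nnegrE// real_normK// num_real.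
  have hu := co (u p) (u q) (ltac:(lra)).
  have hv := co (v p) (v q) (ltac:(lra)).
  have hw := co (w p) (w q) (ltac:(lra)).
  split.
  - have -> : u q = u p - (u p - u q) by ring.
    by apply: le_trans (ler_normB _ _) _; lra.
  - have -> : v q = v p - (v p - v q) by ring.
    by apply: le_trans (ler_normB _ _) _; lra.
  - by move: hw; rewrite ler_norml => /andP[_ hw]; lra.
set B := disc_ratio R M in B0 *.
have p0 : 0 < pi :> R := pi_gt0 R.
(* Chosen so that division by [pi * (l * b)] turns this error into [e / B]. *)
pose E := pi * l * b * e / B.
have E0 : 0 < E by rewrite !mulr_gt0// invr_gt0.
have k20 : 0 < k / 2 by rewrite divr_gt0.
have [r r0' rP] := dloc k20 E0 sep.
have {}rP : (hausdorff2_pre d r D <= hausdorff2_pre (@angle R) r D' + E%:E)%E.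
  by apply: rP; rewrite r0' lexx.
have lower := @patch_lower_bound R d x0 u v w G' l b a s e h n dm dt ad fr GP' l0 b0 bl
  lle e1 (ltW a0) s0 h0 nh f_incr f_lip r r0'.
pose e' := Num.min (r / 8) (r1 / 4).
have e'0 : 0 < e' by rewrite lt_min !divr_gt0.
have e'r : e' <= r / 8 by rewrite ge_min lexx.
have e'r1 : e' <= r1 / 4 by rewrite ge_min lexx orbT.
have upper : (hausdorff2_pre (@angle R) r D' <=
    (pi / 4 * ((1 + e) ^+ 2) ^+ 2 / B * (4 * (l + k) * (b + k)))%:E)%E.
  apply: (@patch_upper_bound R _ (@angle R) D' u v M _ (l + k) (b + k) e' r) => //.
  - exact: sqr_ge0.
  - by rewrite addr_ge0// ltW.
  - by rewrite addr_ge0// ltW.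
  - apply: (@le_trans _ _ (4 * e')); last by lra.
    by rewrite ler_wpM2r// ltW.
  - by move=> p [].
  move=> p q t Dp Dq /andP[t0 te] pqt.
  have cpq := D'dist p q t Dp Dq t0 pqt.
  have cr1 : chord p q < r1.
    apply: le_lt_trans cpq _; apply: (@le_lt_trans _ _ (2 * t)); last by lra.
    by rewrite ler_wpM2r//; lra.
  apply: le_trans (r1P _ _ cr1) _.
  by rewrite expr2 -mulrA ler_wpM2l//; lra.
have := le_trans lower (le_trans rP (leeD upper (lexx _))).
rewrite -EFinD lee_fin -/ws /E /k => fin.
have lb0 : 0 < pi * (l * b) by rewrite !mulr_gt0.
have fin2 : a / ws <= ((1 + e) ^+ 4 * (1 + e) ^+ 2 + e) / B.
  rewrite -(ler_pM2l lb0); apply: le_trans (le_trans fin _).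
    by rewrite le_eqVlt; apply/orP; left; apply/eqP; field; rewrite gt_eqF.
  have lk := collar_area l0 b0 e0 bl.
  have K0 : 0 <= pi * (1 + e) ^+ 4 / B.
    apply: divr_ge0 (ltW B0); apply: mulr_ge0 (ltW p0) _; apply: exprn_ge0.
    by rewrite addr_ge0// ltW.
  have := ler_wpM2l K0 lk.
  have -> : pi / 4 * ((1 + e) ^+ 2) ^+ 2 / B * (4 * (l + e * b) * (b + e * b)) =
    pi * (1 + e) ^+ 4 / B * ((l + e * b) * (b + e * b)).
    by field; rewrite gt_eqF.
  have -> : pi * (l * b) * (((1 + e) ^+ 4 * (1 + e) ^+ 2 + e) / B) =
    pi * (1 + e) ^+ 4 / B * (l * b * (1 + e) ^+ 2) + pi * l * b * e / B.
    by field; rewrite gt_eqF.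
  by rewrite lerD2r.
(* Four factors come from comparing [angle] with planar distance, two from the collar, and a seventh
   absorbs the error [e]. *)
have e7 : (1 + e) ^+ 4 * (1 + e) ^+ 2 + e <= (1 + e) ^+ 7.
  rewrite -exprD (exprS _ 6) mulrDl mul1r lerD2l ler_peMr ?(ltW e0)//.
  by rewrite exprn_ege1// lerDl ltW.
have : a / ws <= (1 + e) ^+ 7 / B.
  by apply: le_trans fin2 _; rewrite ler_pM2r// invr_gt0.
rewrite ler_pdivlMr// mulrAC ler_pdivrMr// /a => fin3.
have := ler_wpM2l (ltW s'0) fin3.
by rewrite (mulVKf (lt0r_neq0 s'0)) mulrCA.
Qed.

(** The bootstrap runs with [A] the Riemann sum over [[0, t]] and [B] the disc ratio;
    [disc_ratio_gt] supplies [A < B]. *)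
Lemma local_slope_lt1 (t : R) : 0 <= t < 1 -> local_slope t.
Proof.
move=> t01; have /andP[t0 t1] := t01.
have [M [n [M0 tMn AB]]] := disc_ratio_gt t01.
have A0 : 0 <= M%:R^-1 * \sum_(k < n) Num.sqrt (1 - (k%:R / M%:R) ^+ 2) :> R.
  by rewrite mulr_ge0 ?invr_ge0// sumr_ge0// => k _; exact: sqrtr_ge0.
have B0 : 0 < disc_ratio R M by apply: le_lt_trans AB.
have slope0 : local_slope 0.
  by exists 1 => // p q _; rewrite mul0r chord_ge0.
apply: (threshold_bootstrap (P := local_slope) A0 AB (disc_ratio_le1 R M) t0).
- move=> s s' s0 ss' [r r0 rP]; exists r => // p q pq.
  have [fpq|fpq] := leP 0 (f p - f q).
    by apply: le_trans (rP p q pq); rewrite ler_wpM2r.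
  by apply: le_trans (chord_ge0 p q); rewrite mulr_ge0_le0// ltW.
- move=> s' s'0 s'N.
  (* From slope 0 with [e = h = n = 1] the weight sum is 1, which yields a first positive slope. *)
  have h11 : 1 <= 1%:R * 1 :> R by rewrite mulr1.
  have e1 : 0 < (1 : R) <= 1 by rewrite ltr01 lexx.
  have := slope_estimate (lexx 0) slope0 s'0 s'N e1 ltr01 h11 B0.
  by rewrite /weight_sum big_ord1 !(mul0r, mulr0) expr0n /= subr0 sqrtr1 !mulr1.
- move=> s s' e s0 st sl s'0 s'N e01.
  have MR : 0 < M%:R :> R by rewrite ltr0n.
  have e10 : 0 < 1 + e by move/andP: e01 => [? _]; rewrite addr_gt0.
  (* This mesh makes the nodes multiples of [M^-1], so the weight sum becomes [(1 + e) / s * A];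
     since [n >= t * M >= s * M], [n] steps reach 1. *)
  have hP : 0 < (1 + e) / (M%:R * s) by rewrite divr_gt0// mulr_gt0.
  have nh : 1 <= n%:R * ((1 + e) / (M%:R * s)).
    have Ms : 0 < M%:R * s by rewrite mulr_gt0.
    rewrite mulrA ler_pdivlMr// mul1r.
    have : M%:R * s <= n%:R by apply: le_trans tMn; rewrite mulrC ler_wpM2r// ltW.
    move/le_trans; apply; rewrite ler_peMr// lerDl.
    by move/andP: e01 => [/ltW].
  have := slope_estimate (ltW s0) sl s'0 s'N e01 hP nh B0.
  suff -> : weight_sum (s / (1 + e)) ((1 + e) / (M%:R * s)) n =
    (1 + e) / s * (M%:R^-1 * \sum_(k < n) Num.sqrt (1 - (k%:R / M%:R) ^+ 2)) by [].
  rewrite /weight_sum.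
  have -> : s / (1 + e) * ((1 + e) / (M%:R * s)) = M%:R^-1.
    by field; rewrite !gt_eqF.
  under eq_bigr do rewrite [_^-1 * _]mulrC.
  by field; rewrite !gt_eqF.
Qed.

(** Slopes arbitrarily close to 1 make [f] locally [(1 + e)]-Lipschitz for the chord, so along the
    great-circle arc from [x0] to [y] it grows by at most the length of the arc, starting from
    [f x0 = 0]. *)
Lemma metric_le_angle (y : S2 R) : d x0 y <= angle x0 y.
Proof.
have rho_lip e : 0 < e -> exists2 r, 0 < r &
    forall p q, chord p q < r -> `|f p - f q| <= (1 + e) * chord p q.
  move=> e0; have e10 : 0 < 1 + e by lra.
  have [|r r0 rP] := @local_slope_lt1 (1 + e)^-1.
    by rewrite invr_ge0 ltW//= invf_lt1//; lra.
  exists r => // p q pq; have := rP p q pq; have := rP q p.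
  rewrite chordC => /(_ pq); rewrite ![(1 + e)^-1 * _]mulrC !ler_pdivrMr//.
  by rewrite ler_norml => h1 h2; apply/andP; split; lra.
have [c Cc cL] := arc_curve x0 y.
have rho_xx p : `|f p - f p| = 0 by rewrite subrr normr0.
have rho_triangle p q r : `|f p - f r| <= `|f p - f q| + `|f q - f r|.
  by rewrite (_ : f p - f r = (f p - f q) + (f q - f r)) ?ler_normD//; ring.
have := curve_length_ge rho_xx rho_triangle rho_lip Cc.
have -> : f x0 = 0 by apply/(Defs.metric_eq0 dm).
by rewrite cL sub0r normrN; apply: le_trans; exact: ler_norm.
Qed.

End Rigidity.

Theorem corollary1p2 (R : realType) :
  admissible (@spherical_dist R) /\
  forall d : S2 R -> S2 R -> R, admissible d ->
    (hausdorff2 (@spherical_dist R) setT <= hausdorff2 d setT)%E /\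
    (hausdorff2 d setT = hausdorff2 (@spherical_dist R) setT ->
     d = @spherical_dist R).
Proof.
have dE : @spherical_dist R = @angle R.
  by apply/funext => x; apply/funext => y; exact: spherical_distE.
split; first by split=> //; rewrite dE; [exact: angle_metric|exact: angle_topology].
move=> d [dm dt sd]; rewrite dE in sd *.
split=> [|Heq]; first exact: le_hausdorff2.
have dloc := eq_hausdorff2_no_local_excess sd (hausdorff2_angle_fin R) Heq.
apply/funext => x; apply/funext => y; apply/eqP; rewrite eq_le sd andbT {Heq}.
exact: metric_le_angle.
Qed.
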